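(* Consider the symmetric Activated Random Walk model with sleep rate $\lambda\in(0,\infty)$ on the ring $\mathbb{Z}_n=\mathbb{Z}/n\mathbb{Z}$, with initial configuration $\eta_0$ i.i.d. Poisson with parameter $\zeta$, all particles being initially active. Let $\mathcal{T}=\sum_{x\in\mathbb{Z}_n}m_{\mathbb{Z}_n,\eta_0}(x)$ be the total number of topplings performed during stabilization of $\eta_0$. Let $0<\zeta<1$. (a) If $\lambda$ is small enough (depending on $\zeta$), there exist $\delta>0$ and $\delta'>0$ such that, for all large $n$, $\mathbb{P}(\mathcal{T}\geqslant e^{\delta' n})\geqslant 1-e^{-\delta n}$. (b) If $\lambda$ is large enough (depending on $\zeta$), there exist $\delta>0$ and $\kappa<\infty$ such that, for all large $n$, $\mathbb{P}(\mathcal{T}\leqslant\kappa n\log^2 n)\geqslant1-n^{-\delta}$.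
   Context: Configurations on $\mathbb{Z}_n$ are elements $\eta\in(\mathbb{N}_{\mathfrak{s}})^{\mathbb{Z}_n}$, where $\mathbb{N}_{\mathfrak{s}}=\{0,1,2,\dots\}\cup\{\mathfrak{s}\}$ is ordered by $0<\mathfrak{s}<1<2<\cdots$; $\eta(x)=k\in\mathbb{N}_0=\{0,1,2,\dots\}$ means $k$ active particles at $x$ and $\eta(x)=\mathfrak{s}$ means one sleeping particle. Conventions: $\mathfrak{s}+1=2$, $1\cdot\mathfrak{s}=\mathfrak{s}$, $k\cdot\mathfrak{s}=k$ for $k\geqslant2$. A site $x$ is unstable for $\eta$ if $\eta(x)\geqslant1$, otherwise stable. Each site $x$ carries an infinite stack of instructions $\mathfrak{t}^{x,1},\mathfrak{t}^{x,2},\dots$, independent over $x$ and $j$ and independent of $\eta_0$: each $\mathfrak{t}^{x,j}$ is a sleep instruction $\mathfrak{t}_{x\mathfrak{s}}$ with probability $\frac{\lambda}{1+\lambda}$ and a jump instruction $\mathfrak{t}_{xy}$ with probability $\frac{1}{2(1+\lambda)}$ for each of the two neighbors $y=x\pm1$ of $x$ in $\mathbb{Z}_n$. The instruction $\mathfrak{t}_{x\mathfrak{s}}$ replaces $\eta(x)$ by $\eta(x)\cdot\mathfrak{s}$; $\mathfrak{t}_{xy}$ replaces $\eta(x)$ by $\eta(x)-1$ and $\eta(y)$ by $\eta(y)+1$. Toppling $x$ means applying to the current configuration the first instruction at $x$ not yet used; it is legal if $x$ is unstable. For a finite sequence of topplings $\beta$, $m_\beta(x)$ is the number of times $x$ appears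 in $\beta$; $m_{\mathbb{Z}_n,\eta_0}(x)=\sup_\beta m_\beta(x)$, the supremum being over all finite sequences $\beta$ of successively legal topplings started from $\eta_0$ (possibly $+\infty$). *)

(* Defs.v *)
From HB Require Import structures.
From mathcomp Require Import all_boot all_order all_algebra finmap.
From mathcomp Require Import all_classical all_reals all_analysis.

Set Implicit Arguments.
Unset Strict Implicit.
Unset Printing Implicit Defensive.
Import Order.TTheory GRing.Theory Num.Theory.

(* N_s: [Active k] is k (in particular [Active 0] is 0), [Sleeping] is s. *)
Inductive site_state := Active of nat | Sleeping.

(* Position in the order 0 < s < 1 < 2 < ... *)
Definition state_rank (e : site_state) : nat :=
  match e with
  | Active 0 => 0
  | Sleeping => 1
  | Active k.+1 => k.+2
  end.

Definition state_le (e f : site_state) : bool := state_rank e <= state_rank f.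

Definition unstable (e : site_state) : bool := state_le (Active 1) e.

(* e + 1, with s + 1 = 2 *)
Definition state_incr (e : site_state) : site_state :=
  match e with Active k => Active k.+1 | Sleeping => Active 2 end.

(* e - 1; the values at the stable states 0 and s are irrelevant, since only
   unstable sites are toppled legally. *)
Definition state_decr (e : site_state) : site_state :=
  match e with Active k => Active k.-1 | Sleeping => Active 0 end.

(* e . s, with 1 . s = s and k . s = k for k >= 2; again irrelevant at 0, s *)
Definition state_sleep (e : site_state) : site_state :=
  match e with Active 1 => Sleeping | _ => e end.

(* In the stack of x, [JumpRight] and [JumpLeft] are t_{x,x+1}, t_{x,x-1}. *)
Inductive instruction := Sleep | JumpLeft | JumpRight.

HB.instance Definition _ := gen_eqMixin instruction.
HB.instance Definition _ := gen_choiceMixin instruction.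
HB.instance Definition _ := isPointed.Build instruction Sleep.
HB.instance Definition _ := @isMeasurable.Build default_measure_display
  instruction discrete_measurable discrete_measurable0
  discrete_measurableC discrete_measurableU.

(* The ring Z_n is 'I_n, with x + 1 = [ordS x] and x - 1 = [ord_pred x]. *)
Definition config (n : nat) := 'I_n -> site_state.

Definition update (T : Type) (n : nat) (x : 'I_n) (g : T -> T)
  (f : 'I_n -> T) : 'I_n -> T := fun y => if y == x then g (f y) else f y.

Definition apply_instruction (n : nat) (x : 'I_n) (i : instruction)
    (eta : config n) : config n :=
  match i with
  | Sleep => update x state_sleep eta
  | JumpLeft => update (ord_pred x) state_incr (update x state_decr eta)
  | JumpRight => update (ordS x) state_incr (update x state_decr eta)
  end.

(* [tau x j] is the instruction t^{x,j+1}: stacks are indexed from 0. *)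
Definition stacks (n : nat) := 'I_n -> nat -> instruction.

(* [legal_from tau eta h beta]: performing the topplings beta in order, from
   the configuration eta with h x instructions already used at each x, every
   toppling is legal. *)
Fixpoint legal_from (n : nat) (tau : stacks n) (eta : config n)
    (h : 'I_n -> nat) (beta : seq 'I_n) : bool :=
  match beta with
  | [::] => true
  | x :: beta' =>
      unstable (eta x) &&
      legal_from tau (apply_instruction x (tau x (h x)) eta)
        (update x S h) beta'
  end.

Definition legal (n : nat) (tau : stacks n) (eta : config n)
  (beta : seq 'I_n) : bool := legal_from tau eta (fun=> 0) beta.

Local Open Scope classical_set_scope.
Local Open Scope ring_scope.

(* m_{Z_n, eta}(x), possibly +oo; m_beta(x) is [count_mem x beta]. *)
Definition odometer (R : realType) (n : nat) (tau : stacks n) (eta : config n)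
    (x : 'I_n) : \bar R :=
  ereal_sup [set ((count_mem x beta)%:R)%:E | beta in [set beta | legal tau eta beta]].

Definition total_topplings (R : realType) (n : nat) (tau : stacks n)
    (eta : config n) : \bar R :=
  (\sum_(x < n) odometer R tau eta x)%E.

Definition mutually_independent (R : realType) (d : measure_display)
    (Omega : measurableType d) (P : probability Omega R) (I : choiceType)
    (F : I -> set (set Omega)) : Prop :=
  forall (J : {fset I}) (A : I -> set Omega),
    (forall i, i \in J -> F i (A i)) ->
    P (\bigcap_(i in [set` J]) A i) = (\prod_(i <- J) P (A i))%E.

Definition sigma_of (d d' : measure_display) (Omega : measurableType d)
    (T : measurableType d') (X : Omega -> T) : set (set Omega) :=
  [set X @^-1` B | B in measurable].

Definition instruction_pmf (R : realType) (lambda : R) (i : instruction) : R :=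
  match i with
  | Sleep => lambda / (1 + lambda)
  | JumpLeft | JumpRight => 1 / (2 * (1 + lambda))
  end.

(* [N x] is the initial number of particles at x, [tau x j] the random
   instruction t^{x,j+1}; the whole family (N, tau) is mutually independent. *)
Definition arw_law (R : realType) (lambda zeta : R) (n : nat)
    (d : measure_display) (Omega : measurableType d) (P : probability Omega R)
    (N : 'I_n -> {RV P >-> nat})
    (tau : 'I_n -> nat -> {RV P >-> instruction}) : Prop :=
  [/\ forall x k, distribution P (N x) [set k] = (poisson_pmf zeta k)%:E,
      forall x j i,
        distribution P (tau x j) [set i] = (instruction_pmf lambda i)%:E &
      mutually_independent P
        (fun a : 'I_n + 'I_n * nat =>
           match a with
           | inl x => sigma_of (N x)
           | inr (x, j) => sigma_of (tau x j)
           end)].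

(* eta_0 = [Active \o N]: all the particles are initially active. *)
Definition arw_total (R : realType) (n : nat) (d : measure_display)
    (Omega : measurableType d) (P : probability Omega R)
    (N : 'I_n -> {RV P >-> nat})
    (tau : 'I_n -> nat -> {RV P >-> instruction}) (w : Omega) : \bar R :=
  total_topplings R (fun x j => tau x j w) (fun x => Active (N x w)).

(* Main.v *)
Require Import Defs.
From mathcomp Require Import all_boot all_order all_algebra finmap.
From mathcomp Require Import all_classical all_reals all_analysis.
From mathcomp Require Import measurable_realfun ring lra zify.

(* Both parts are first-moment estimates over odometers, explored from left to
   right. Let W(x) be the word of instructions used at x by a stabilizing legal
   sequence, L and R its numbers of left and right jumps, and sigma(x) in {0, 1}
   the final number of particles at x, which is 1 iff W(x) ends with a sleep
   instruction. The net flow f(x) = R(W(x)) - L(W(x+1)) through the edge (x, x+1)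
   satisfies f(x) = f(x-1) + eta_0(x) - sigma(x), so the exploration up to x
   determines L(W(x+1)) = R(W(x)) - f(x). Given L(W(x)), the expected number of
   possible words W(x) is at most 2 lambda / (1 + lambda) with sigma(x) = 1, at
   most 2 / (1 + lambda) with sigma(x) = 0 and W(x) nonempty, and at most 1 with
   W(x) empty; the second bound uses that the instruction before the last one of
   a stable site is never a sleep instruction.

   (a) A stabilization with few topplings yields such a chain of words around
   the ring, in which sigma = 1 on at least zeta n / 2 sites. There are at
   most e^(O(n)) ways to start the chain, and each sleeping particle costs a
   factor lambda.

   (b) Freeze the particles at a sink y. A maximal run of k sites with nonempty
   words receives no particle from outside, so that at most about zeta k of its
   sites have sigma = 1, and the other ones cost a factor 1 / (1 + lambda) each:
   all the runs have length O(log n). Exponential moments of R bound the number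
   of visits in a run of length l by O(l^2). Finally the odometers of two sinks,
   the second one chosen among the unvisited sites of the first one, are glued
   into a stabilizing function, which bounds the true odometer by the least
   action principle. *)

Set Implicit Arguments.
Unset Strict Implicit.
Unset Printing Implicit Defensive.
Import Order.TTheory GRing.Theory Num.Theory.
Import numFieldNormedType.Exports.

(** * Odometers and the least action principle *)

Definition jumps_left (i : instruction) := if i is JumpLeft then true else false.
Definition jumps_right (i : instruction) := if i is JumpRight then true else false.
Definition is_sleep (i : instruction) := if i is Sleep then true else false.

(* Words list the instructions of a site that have been used, the most recent
   one first. *)
Local Notation word := (seq instruction).

Definition lefts (w : word) := count jumps_left w.
Definition rights (w : word) := count jumps_right w.

Definition ends_asleep (w : word) := if w is i :: _ then is_sleep i else false.

(** After a sleep instruction a site holds [Sleeping] or at least two particles. It thus holds at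
    least two at its next legal toppling, which cannot stabilize it. *)
Definition admissible (w : word) := ~~ ends_asleep (behead w).

Definition used (n : nat) (tau : stacks n) (x : 'I_n) (u : nat) : word :=
  rev (mkseq (tau x) u).

Lemma usedS n (tau : stacks n) x u : used tau x u.+1 = tau x u :: used tau x u.
Proof. by rewrite /used mkseqS rev_rcons. Qed.

Lemma size_used n (tau : stacks n) x u : size (used tau x u) = u.
Proof. by rewrite /used size_rev size_mkseq. Qed.

Lemma leq_count_used n (tau : stacks n) (a : pred instruction) x u v : u <= v ->
  count a (used tau x u) <= count a (used tau x v).
Proof.
move=> /subnK <-; elim: (v - u) => // k IH.
by rewrite addSn usedS /= (leq_trans IH) // leq_addl.
Qed.

Definition occupation (e : site_state) : nat :=
  match e with Active k => k | Sleeping => 1 end.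

(* What the last two instructions used at a site tell about its state, when all
   the topplings were legal. *)
Definition compatible (e : site_state) (w : word) : bool :=
  match w with
  | [::] => if e is Sleeping then false else true
  | Sleep :: v =>
      match e with
      | Active k => 1 < k
      | Sleeping => ~~ ends_asleep v
      end
  | _ :: v =>
      match e with
      | Active k => ends_asleep v ==> (0 < k)
      | Sleeping => false
      end
  end.

Definition progress (n : nat) (tau : stacks n) (ini : 'I_n -> nat)
    (eta : config n) (h : 'I_n -> nat) : Prop :=
  forall x, compatible (eta x) (used tau x (h x)) /\
    occupation (eta x) + lefts (used tau x (h x)) + rights (used tau x (h x)) =
    ini x + rights (used tau (ord_pred x) (h (ord_pred x))) +
            lefts (used tau (ordS x) (h (ordS x))).

Lemma updateE T n (x : 'I_n) (g : T -> T) f y :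
  update x g f y = if y == x then g (f y) else f y.
Proof. by []. Qed.

Lemma occupation_incr e : occupation (state_incr e) = (occupation e).+1.
Proof. by case: e. Qed.

Lemma occupation_decr e : unstable e -> (occupation (state_decr e)).+1 = occupation e.
Proof. by case: e => [[|k]|]. Qed.

Lemma occupation_sleep e : occupation (state_sleep e) = occupation e.
Proof. by case: e => [[|[|k]]|]. Qed.

Lemma compatible_incr e w : compatible e w -> compatible (state_incr e) w.
Proof.
by case: w => [|[] v]; case: e => [k|] //= H; rewrite ?implybT //; lia.
Qed.

Lemma compatible_sleep e w : unstable e -> compatible e w ->
  compatible (state_sleep e) (Sleep :: w).
Proof. by case: e => [[|[|k]]|] //=; case: w => [|[] v]. Qed.

Lemma compatible_decr e i w : ~~ is_sleep i -> unstable e -> compatible e w ->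
  compatible (state_decr e) (i :: w).
Proof.
case: i => //= _; case: e => [[|k]|] //= _.
  by case: w => [|[] v].
by case: w => [|[] v].
Qed.

Lemma stable_compatible e w : ~~ unstable e -> compatible e w ->
  occupation e = ends_asleep w /\ admissible w.
Proof.
rewrite /admissible.
by case: e => [[|k]|] //= _; case: w => [|[] v] //=; case: ends_asleep.
Qed.

Lemma unstable_compatible e w : unstable e -> compatible e w ->
  ends_asleep w < occupation e.
Proof. by case: e => [[|[|k]]|] // _; case: w => [|[] v]. Qed.

Lemma progress_topple n (tau : stacks n) ini eta h x :
  progress tau ini eta h -> unstable (eta x) ->
  progress tau ini (apply_instruction x (tau x (h x)) eta) (update x S h).
Proof.
move=> P ux y; have [Py1 Py2] := P y; have [Px1 Px2] := P x; split.
  rewrite updateE; case: (eqVneq y x) => [->|yx].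
    rewrite usedS; case: (tau x (h x)); rewrite /apply_instruction !updateE eqxx.
    - exact: compatible_sleep.
    - by case: ifP => _; rewrite ?updateE ?eqxx; [apply: compatible_incr|];
         apply: compatible_decr.
    - by case: ifP => _; rewrite ?updateE ?eqxx; [apply: compatible_incr|];
         apply: compatible_decr.
  case: (tau x (h x)); rewrite /apply_instruction !updateE (negPf yx) //;
    by case: ifP => // _; apply: compatible_incr.
have used_upd z : used tau z (update x S h z) =
    if z == x then tau x (h x) :: used tau x (h x) else used tau z (h z).
  by rewrite updateE; case: eqP => [->|//]; rewrite usedS.
have eqp : (ord_pred y == x) = (y == ordS x).
  by rewrite -(inj_eq (@ordS_inj n)) ord_predK.
have eqs : (ordS y == x) = (y == ord_pred x).
  by rewrite -(inj_eq (@ord_pred_inj n)) ordSK.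
rewrite !used_upd eqp eqs.
have odec := occupation_decr ux.
(* Each count changes by an indicator. Several indicators may hold at once, since neighbors coincide
   for n at most 2. *)
have -> : lefts (if y == x then tau x (h x) :: used tau x (h x) else used tau y (h y))
   = (y == x) * jumps_left (tau x (h x)) + lefts (used tau y (h y)).
  by case: eqP => [->|_] //=; rewrite ?mul1n ?mul0n.
have -> : rights (if y == x then tau x (h x) :: used tau x (h x) else used tau y (h y))
   = (y == x) * jumps_right (tau x (h x)) + rights (used tau y (h y)).
  by case: eqP => [->|_] //=; rewrite ?mul1n ?mul0n.
have -> : rights (if y == ordS x then tau x (h x) :: used tau x (h x)
    else used tau (ord_pred y) (h (ord_pred y)))
   = (y == ordS x) * jumps_right (tau x (h x)) + rights (used tau (ord_pred y) (h (ord_pred y))).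
  by case: eqP => [->|_] //=; rewrite ?mul1n ?mul0n ?ordSK.
have -> : lefts (if y == ord_pred x then tau x (h x) :: used tau x (h x)
    else used tau (ordS y) (h (ordS y)))
   = (y == ord_pred x) * jumps_left (tau x (h x)) + lefts (used tau (ordS y) (h (ordS y))).
  by case: eqP => [->|_] //=; rewrite ?mul1n ?mul0n ?ord_predK.
case E: (tau x (h x)) => /=; rewrite ?muln0 ?muln1 ?add0n.
- rewrite updateE -Py2; case: eqP => [->|_] //; by rewrite occupation_sleep.
- rewrite !updateE; case: (eqVneq y x) => [yx|_] /=; last first.
    by case: eqP => _; rewrite ?occupation_incr ?muln0 ?add0n ?addn0 //=; lia.
  subst y; case: eqP => _; rewrite ?occupation_incr; lia.
- rewrite !updateE; case: (eqVneq y x) => [yx|_] /=; last first.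
    by case: eqP => _; rewrite ?occupation_incr ?muln0 ?add0n ?addn0 //=; lia.
  subst y; case: eqP => _; rewrite ?occupation_incr; lia.
Qed.

Lemma progress0 n (tau : stacks n) ini :
  progress tau ini (fun x => Active (ini x)) (fun=> 0).
Proof. by move=> x; split. Qed.

Fixpoint final (n : nat) (tau : stacks n) (eta : config n) (h : 'I_n -> nat)
    (beta : seq 'I_n) : config n :=
  if beta is x :: beta' then
    final tau (apply_instruction x (tau x (h x)) eta) (update x S h) beta'
  else eta.

Definition visits n (h : 'I_n -> nat) (beta : seq 'I_n) (x : 'I_n) :=
  h x + count_mem x beta.

Lemma visits_cons n (h : 'I_n -> nat) x beta :
  visits h (x :: beta) = visits (update x S h) beta.
Proof.
apply/funext => y; rewrite /visits updateE /= eq_sym.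
by case: eqP; rewrite ?addnA ?addn1 ?add0n.
Qed.

Lemma legal_from_rcons n (tau : stacks n) eta h beta x :
  legal_from tau eta h (rcons beta x) =
  legal_from tau eta h beta && unstable (final tau eta h beta x).
Proof.
elim: beta eta h => [|z beta IH] eta h /=; first by rewrite andbT.
by rewrite IH andbA.
Qed.

Lemma progress_final n (tau : stacks n) ini eta h beta :
  progress tau ini eta h -> legal_from tau eta h beta ->
  progress tau ini (final tau eta h beta) (visits h beta).
Proof.
elim: beta eta h => [|x beta IH] eta h P /=.
  have -> : visits h [::] = h by apply/funext => x; rewrite /visits addn0.
  by [].
by move=> /andP[ux /IH]; rewrite visits_cons; apply; apply: progress_topple.
Qed.

(** The topplings counted by v need not be legal: they leave at most one particle at x, and only
    after a final sleep instruction. Unlike an equality, this inequality survives gluing by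
    minima. *)
Definition stabilizing (n : nat) (tau : stacks n) (ini v : 'I_n -> nat) (x : 'I_n) :=
  ini x + rights (used tau (ord_pred x) (v (ord_pred x)))
        + lefts (used tau (ordS x) (v (ordS x))) <=
  ends_asleep (used tau x (v x)) + lefts (used tau x (v x))
        + rights (used tau x (v x)).

(* Least action principle: no legal sequence can leave the box below v, since
   a site x visited exactly v x times so far cannot be unstable. *)
Lemma least_action n (tau : stacks n) ini v eta h beta :
  (forall x, stabilizing tau ini v x) -> progress tau ini eta h ->
  (forall x, h x <= v x) -> legal_from tau eta h beta ->
  forall x, visits h beta x <= v x.
Proof.
move=> stab; elim: beta eta h => [|x beta IH] eta h P hv /=.
  by move=> _ x; rewrite /visits addn0.
move=> /andP[ux] /(IH _ _ (progress_topple P ux)); rewrite visits_cons; apply.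
move=> y; rewrite updateE; case: eqP => // ->.
rewrite ltn_neqAle hv andbT; apply/eqP => hvx.
have [Px1 Px2] := P x; have := unstable_compatible ux Px1.
have := stab x; rewrite /stabilizing -hvx.
(* The neighbors have sent to x at most what they send under v, and x has sent exactly as much. So x
   holds at most [ends_asleep] particles, against [unstable_compatible]. *)
have := leq_count_used tau jumps_right (ord_pred x) (hv (ord_pred x)).
have := leq_count_used tau jumps_left (ordS x) (hv (ordS x)).
rewrite -/(lefts _) -/(lefts _) -/(rights _) -/(rights _); lia.
Qed.

(** * Chains of words *)

(** An entry is the initial number of particles and the word of a site. Here r counts the right
    jumps of the site before the first entry, and f is the net flow through the edge between
    them. *)
Fixpoint chain (r : nat) (f : int) (l : seq (nat * word)) : bool :=
  if l is (k, w) :: l' then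
    [&& admissible w, ((lefts w)%:Z + f == r%:Z)%R &
        chain (rights w) (f + k%:Z - (ends_asleep w)%:Z)%R l']
  else true.

Definition last_rights (r : nat) (l : seq (nat * word)) : nat :=
  last r [seq rights a.2 | a <- l].

Definition particles (l : seq (nat * word)) : nat := sumn [seq a.1 | a <- l].
Definition sleepers (l : seq (nat * word)) : nat := count (fun a => ends_asleep a.2) l.

Definition site_data n (tau : stacks n) (ini u : 'I_n -> nat) (x : 'I_n) :=
  (ini x, used tau x (u x)).

Definition flow n (tau : stacks n) (u : 'I_n -> nat) (a : 'I_n) : int :=
  ((rights (used tau a (u a)))%:Z - (lefts (used tau (ordS a) (u (ordS a))))%:Z)%R.

(** What is kept of the stability of x once the configuration is forgotten. *)
Definition settled n (tau : stacks n) (ini u : 'I_n -> nat) (x : 'I_n) : bool :=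
  admissible (used tau x (u x)) &&
  (ends_asleep (used tau x (u x)) + lefts (used tau x (u x)) + rights (used tau x (u x))
   == ini x + rights (used tau (ord_pred x) (u (ord_pred x)))
            + lefts (used tau (ordS x) (u (ordS x)))).

(** The site a is left out: the chain along the arc starts from its right jumps and from the flow
    out of it. *)
Definition stretch n (a : 'I_n) k := traject (@ordS n) (ordS a) k.

Lemma settled_flow n (tau : stacks n) ini u x : settled tau ini u (ordS x) ->
  flow tau u (ordS x) =
  (flow tau u x + (ini (ordS x))%:Z - (ends_asleep (used tau (ordS x) (u (ordS x))))%:Z)%R.
Proof. by rewrite /settled /flow ordSK => /andP[_ /eqP]; lia. Qed.

Lemma settled_chain n (tau : stacks n) ini u a k :
  all (settled tau ini u) (stretch a k) ->
  chain (rights (used tau a (u a))) (flow tau u a)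
    [seq site_data tau ini u x | x <- stretch a k].
Proof.
elim: k a => //= k IH a /andP[sa sk]; apply/and3P; split.
- by case/andP: sa.
- by rewrite /flow; lia.
- by rewrite -settled_flow //; apply: IH.
Qed.

Lemma flow_stretch n (tau : stacks n) ini u a k :
  all (settled tau ini u) (stretch a k) ->
  let l := [seq site_data tau ini u x | x <- stretch a k] in
  (flow tau u (iter k (@ordS n) a) = flow tau u a + (particles l)%:Z - (sleepers l)%:Z)%R.
Proof.
elim: k a => [|k IH] a /=; first by rewrite subr0 addr0.
move=> /andP[sa sk]; rewrite -iterS iterSr IH // (settled_flow sa).
by rewrite /particles /sleepers /stretch /= !PoszD; ring.
Qed.

Lemma last_rights_stretch n (tau : stacks n) ini u a k :
  last_rights (rights (used tau a (u a))) [seq site_data tau ini u x | x <- stretch a k] =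
  rights (used tau (iter k (@ordS n) a) (u (iter k (@ordS n) a))).
Proof.
elim: k a => [|k IH] a //=.
by rewrite -iterS iterSr -IH.
Qed.

Lemma sleepers_le l : sleepers l <= size l.
Proof. exact: count_size. Qed.

(** * Arcs of the ring *)

Lemma val_iter_ordS n (a : 'I_n) k : val (iter k (@ordS n) a) = (a + k) %% n.
Proof.
elim: k => [|k IH] /=; first by rewrite addn0 modn_small.
by rewrite IH -addn1 modnDml addn1 addnS.
Qed.

Lemma iter_ordS_inj n (a : 'I_n) i j : i < n -> j < n ->
  iter i (@ordS n) a = iter j (@ordS n) a -> i = j.
Proof.
move=> ni nj /(congr1 val); rewrite !val_iter_ordS => /eqP.
by rewrite eqn_modDl !modn_small // => /eqP.
Qed.

Lemma iter_ordS_n n (a : 'I_n) : iter n (@ordS n) a = a.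
Proof. by apply: val_inj; rewrite val_iter_ordS modnDr modn_small. Qed.

Lemma iter_ordS_onto n (a x : 'I_n) : exists2 i, i < n & x = iter i (@ordS n) a.
Proof.
have n0 : 0 < n by case: x => [[|m] ] /= H; lia.
exists ((x + (n - a)) %% n); first by rewrite ltn_mod.
apply: val_inj; rewrite val_iter_ordS modnDmr.
by rewrite addnCA subnKC ?(ltnW (ltn_ord a)) // modnDr modn_small.
Qed.

Lemma size_stretch n (a : 'I_n) k : size (stretch a k) = k.
Proof. exact: size_traject. Qed.

Lemma nth_stretch n (a : 'I_n) k i : i < k -> nth a (stretch a k) i = iter i.+1 (@ordS n) a.
Proof. by move=> ik; rewrite (set_nth_default (ordS a)) ?size_stretch // nth_traject // iterSr. Qed.

Lemma stretchP n (a : 'I_n) k x :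
  reflect (exists2 i, 0 < i <= k & x = iter i (@ordS n) a) (x \in stretch a k).
Proof.
apply: (iffP trajectP) => [[i ik ->]|[[|i] //= ik ->]].
  by exists i.+1 => //; rewrite iterSr.
by exists i => //; rewrite -iterS iterSr.
Qed.

Lemma uniq_stretch n (a : 'I_n) k : k <= n -> uniq (stretch a k).
Proof.
move=> kn; apply/(uniqP a) => i j; rewrite !inE size_stretch => ik jk.
rewrite !nth_stretch // !iterS => /ordS_inj /iter_ordS_inj; apply; lia.
Qed.

Lemma exists_maximal (T : Type) (p : pred (seq T)) B :
  p [::] -> (forall s, p s -> size s <= B) ->
  exists2 s, p s & forall x, ~~ p (rcons s x).
Proof.
move=> p0 pB; apply: contrapT => H.
have ext s : p s -> exists x, p (rcons s x).
  move=> ps; apply: contrapT => nx; apply: H; exists s => // x.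
  by apply/negP => px; apply: nx; exists x.
have /(_ B.+1)[s ps ss] : forall m, exists2 s, p s & size s = m.
  elim=> [|m [s ps ss]]; first by exists [::].
  by have [x px] := ext s ps; exists (rcons s x); rewrite ?size_rcons ?ss.
by have := pB s ps; rewrite ss ltnn.
Qed.

Definition topplings n (beta : seq 'I_n) (x : 'I_n) := count_mem x beta.

Lemma sum_topplings n (beta : seq 'I_n) : \sum_x topplings beta x = size beta.
Proof.
elim: beta => [|z s IH] /=; first by rewrite big1.
rewrite /topplings /= big_split /= -/(topplings _) IH.
rewrite (bigD1 z) //= eqxx big1 ?addn0 // => i; rewrite eq_sym => /negPf ->.
by [].
Qed.

Lemma progress_legal n (tau : stacks n) ini beta :
  legal tau (fun x => Active (ini x)) beta ->
  progress tau ini (final tau (fun x => Active (ini x)) (fun=> 0) beta) (topplings beta).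
Proof.
move=> /(progress_final (progress0 tau ini)).
by have -> : visits (fun=> 0) beta = topplings beta by [].
Qed.

Lemma stable_settled n (tau : stacks n) ini eta u x :
  progress tau ini eta u -> ~~ unstable (eta x) -> settled tau ini u x.
Proof.
move=> P sx; have [Px1 Px2] := P x.
by have [oE ax] := stable_compatible sx Px1; rewrite /settled ax -oE Px2 eqxx.
Qed.

(** Each jump is counted once where it leaves and once where it arrives, so the jumps cancel in the
    sum over all sites. *)
Lemma progress_total n (tau : stacks n) ini eta u : progress tau ini eta u ->
  \sum_x occupation (eta x) = \sum_x ini x.
Proof.
move=> P.
have /eqP : \sum_x (occupation (eta x) + lefts (used tau x (u x)) + rights (used tau x (u x)))
  = \sum_x (ini x + rights (used tau (ord_pred x) (u (ord_pred x)))
            + lefts (used tau (ordS x) (u (ordS x)))).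
  by apply: eq_bigr => x _; case: (P x).
rewrite !big_split /=.
have <- : \sum_x lefts (used tau x (u x)) =
    \sum_x lefts (used tau (ordS x) (u (ordS x))).
  by rewrite [LHS](reindex_inj (@ordS_inj n)).
have <- : \sum_x rights (used tau x (u x)) =
    \sum_x rights (used tau (ord_pred x) (u (ord_pred x))).
  by rewrite [LHS](reindex_inj (@ord_pred_inj n)).
rewrite (addnAC (\sum_x ini x)) !eqn_add2r.
by move=> /eqP.
Qed.

(** * Subcritical stabilization with sinks *)

Lemma topplings_rcons n (beta : seq 'I_n) x y :
  topplings (rcons beta x) y = topplings beta y + (x == y).
Proof. by rewrite /topplings -cats1 count_cat /= addn0. Qed.

Lemma topplings_le_size n (beta : seq 'I_n) x : topplings beta x <= size beta.
Proof. exact: count_size. Qed.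

Lemma bounded_stabilization n (tau : stacks n) ini M :
  (forall beta, legal tau (fun x => Active (ini x)) beta -> size beta <= M) ->
  exists2 u : 'I_n -> nat, (forall x, u x <= M) & forall x, settled tau ini u x.
Proof.
move=> bM.
have [beta lb max] := exists_maximal (p := legal tau (fun x => Active (ini x))) isT bM.
exists (topplings beta) => x.
  exact: leq_trans (topplings_le_size _ _) (bM _ lb).
apply: stable_settled (progress_legal lb) _.
by have := max x; rewrite /legal legal_from_rcons -/(legal _ _ _) lb.
Qed.

(** Take a maximal sequence among those that never topple the sink y and topple no site more than H
    times. The cap makes it exist before termination is known, and bounds the words to enumerate. *)
Lemma capped_stabilization n (tau : stacks n) ini (y : 'I_n) H :
  exists u : 'I_n -> nat, [/\ u y = 0, forall x, u x <= H,
    forall x, x != y -> u x < H -> settled tau ini u x &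
    lefts (used tau (ordS y) (u (ordS y))) <= \sum_x ini x].
Proof.
pose p beta := [&& legal tau (fun x => Active (ini x)) beta, topplings beta y == 0 &
  [forall x, topplings beta x <= H]].
have p0 : p [::] by apply/and3P; split => //; apply/forallP.
have pB beta : p beta -> size beta <= n * H.
  case/and3P => _ _ /forallP bH.
  rewrite -sum_topplings -[n in n * _]card_ord -sum_nat_const.
  exact: leq_sum.
have [beta /and3P[lb /eqP by0 /forallP bH] max] := exists_maximal p0 pB.
have P := progress_legal lb.
exists (topplings beta); split => // [x xy xH|].
  apply: stable_settled P _.
  apply: contraNN (max x) => ux.
  apply/and3P; split.
  - by rewrite /legal legal_from_rcons -/(legal _ _ _) lb.
  - by rewrite topplings_rcons by0 (negPf xy).
  - apply/forallP => z; rewrite topplings_rcons.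
    by case: eqP => [<-|_]; [rewrite addn1 | rewrite addn0].
rewrite -(progress_total P) (bigD1 y) //=.
have [_] := P y; rewrite by0 /used /=; lia.
Qed.

(** * Deterministic bound on the good event *)

Section Subcritical.

Variables (n : nat) (tau : stacks n) (ini : 'I_n -> nat).
Variables (ell B H : nat) (dens : nat -> nat).

Hypothesis ell_gt0 : 0 < ell.
Hypothesis ell_le : 4 * ell < n.
Hypothesis few : \sum_x ini x <= n.
Hypothesis sparse : forall (a : 'I_n) k, ell <= k <= n -> sumn [seq ini x | x <- stretch a k] <= dens k.
Hypothesis H_large : B * (32 * n * n + 2 * n) <= H.

Let data (u : 'I_n -> nat) := site_data tau ini u.

Hypothesis no_full_chain : forall (u : 'I_n -> nat) a k m0, (forall x, u x <= H) ->
  ell <= k < n -> m0 <= n -> all (fun x => 0 < u x) (stretch a k) ->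
  chain 0 (- m0%:Z)%R [seq data u x | x <- stretch a k] ->
  dens k < sleepers [seq data u x | x <- stretch a k].

(** Used with b = [ell] for the runs between unvisited sites, and with b = n to show that the cap H
    is not reached. *)
Let low b := forall (u : 'I_n -> nat) a k m0, (forall x, u x <= H) ->
  k <= b -> k < n -> m0 <= n ->
  chain 0 (- m0%:Z)%R [seq data u x | x <- stretch a k] ->
  last_rights 0 [seq data u x | x <- stretch a k] < 16 * b * (b + m0).

Hypothesis low_ell : low ell.
Hypothesis low_n : low n.

(** Turns a bound on the left jumps of a site into a bound on its topplings. *)
Let quick h := forall x, h < lefts (used tau x (B * h)).

Hypothesis quick1 : quick (17 * ell * ell).
Hypothesis quick2 : quick (17 * ell * (ell + n)).
Hypothesis quick3 : quick (32 * n * n + 2 * n).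

(** The left jumps at x are the right jumps of the previous site minus the flow in between, and the
    flow, starting from -m0, drops by at most one per site. *)
Lemma chain_lefts u a k m0 x :
  all (settled tau ini u) (stretch a k) -> flow tau u a = (- m0%:Z)%R -> k <= n ->
  x = iter k.+1 (@ordS n) a ->
  lefts (used tau x (u x)) <= last_rights (rights (used tau a (u a))) [seq data u z | z <- stretch a k] + m0 + k.
Proof.
move=> sa fa kn ->; rewrite last_rights_stretch.
have := flow_stretch sa; have := sleepers_le [seq data u z | z <- stretch a k].
rewrite size_map size_stretch fa /data /flow /= -!iterS; lia.
Qed.

Lemma quick_visits u x h : quick h -> lefts (used tau x (u x)) <= h -> u x <= B * h.
Proof.
move=> qh lh; rewrite leqNgt; apply/negP => /ltnW uh.
have := leq_count_used tau jumps_left x uh; have := qh x.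
by rewrite -/(lefts _) -/(lefts _); lia.
Qed.

(** Positions are counted to the right of the sink y. Far from y, the exploration starts at an
    unvisited site other than y, with zero flow; near y it may start at the sink, which absorbs up
    to n particles, hence the weaker bound. *)
Record good_odometer (y : 'I_n) (w : 'I_n -> nat) : Prop := GoodOdometer {
  go_sink : w y = 0;
  go_settled : forall x, x != y -> settled tau ini w x;
  go_zero : forall i, i + ell < n ->
     exists2 j, i < j <= i + ell & w (iter j (@ordS n) y) = 0;
  go_far : forall i, ell <= i < n -> w (iter i (@ordS n) y) <= B * (17 * ell * ell);
  go_near : forall i, i < n -> w (iter i (@ordS n) y) <= B * (17 * ell * (ell + n)) }.

Lemma iter_neq (y : 'I_n) i : 0 < i < n -> iter i (@ordS n) y != y.
Proof.
move=> /andP[i0 iN]; apply/eqP => /(@iter_ordS_inj n y i 0 iN) h.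
by have := h ltac:(lia); lia.
Qed.

Lemma exists_good_odometer y : exists w, good_odometer y w.
Proof.
have [u [uy uH uS uL]] := capped_stabilization tau ini y H.
have LyN : lefts (used tau (ordS y) (u (ordS y))) <= n by exact: leq_trans few.
have fy : flow tau u y = (- (lefts (used tau (ordS y) (u (ordS y))))%:Z)%R.
  by rewrite /flow uy /used /= sub0r.
have ry : rights (used tau y (u y)) = 0 by rewrite uy.
(* By induction the sites between the sink and position i are settled, so [low_n] and [quick3] keep
   the visits there below the cap. *)
have nocap i : 0 < i < n -> u (iter i (@ordS n) y) < H.
  elim/ltn_ind: i => i IH iN.
  have sa : all (settled tau ini u) (stretch y i.-1).
    apply/allP => x /stretchP[j ji ->]; apply: uS; first by apply: iter_neq; lia.
    by apply: IH; lia.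
  have ch := settled_chain sa; rewrite ry fy in ch.
  have lr := low_n uH (_ : i.-1 <= n) (_ : i.-1 < n) LyN ch.
  have := chain_lefts sa fy (_ : i.-1 <= n) (_ : iter i (@ordS n) y = iter i.-1.+1 (@ordS n) y).
  rewrite ry prednK; last by case/andP: iN.
  move=> /(_ ltac:(lia) erefl) ll.
  have ll2 : lefts (used tau (iter i (@ordS n) y) (u (iter i (@ordS n) y))) <= 32 * n * n + 2 * n.
    have := lr ltac:(lia) ltac:(lia); nia.
  rewrite ltnNge; apply/negP => uh.
  have := leq_count_used tau jumps_left (iter i (@ordS n) y) (leq_trans H_large uh).
  by have := quick3 (iter i (@ordS n) y); rewrite -!/(lefts _); lia.
have st x : x != y -> settled tau ini u x.
  move=> xy; apply: uS => //; have [i iN xE] := iter_ordS_onto y x.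
  rewrite xE; apply: nocap; rewrite iN andbT lt0n; apply/eqP => i0.
  by move: xy; rewrite xE i0 eqxx.
(* An unvisited site other than the sink is settled with an empty word: nothing was sent to it, and
   the flow out of it vanishes. *)
have starts lo : lo < n -> u (iter lo (@ordS n) y) = 0 ->
    exists m0, [/\ m0 <= n, 0 < lo -> m0 = 0 &
      flow tau u (iter lo (@ordS n) y) = (- m0%:Z)%R].
  move=> loN ulo; have [->|lo0] := posnP lo.
    by exists (lefts (used tau (ordS y) (u (ordS y)))).
  exists 0; split => //.
  have lor : 0 < lo < n by rewrite lo0.
  have /andP[_] := st _ (iter_neq y lor); rewrite /flow ulo {1 2 3}/used /=; lia.
have st_stretch lo k : lo + k < n -> all (settled tau ini u) (stretch (iter lo (@ordS n) y) k).
  move=> lk; apply/allP => x /stretchP[j ji ->]; rewrite -iterD; apply: st.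
  by apply: iter_neq; lia.
(* Otherwise the last zero lo up to i and the first zero hi beyond i + [ell] bound a run of at least
   [ell] visited sites; hi = n is the sink after a full turn. Nothing enters the run, so it has no
   more sleepers than particles, against [no_full_chain]. *)
have zero i : i + ell < n -> exists2 j, i < j <= i + ell & u (iter j (@ordS n) y) = 0.
  move=> iN; apply: contrapT => nz.
  have [lo /andP[loi /eqP ulo] lomax] : exists2 lo, (lo <= i) && (u (iter lo (@ordS n) y) == 0) &
     forall j, (j <= i) && (u (iter j (@ordS n) y) == 0) -> j <= lo.
    have ex : exists j, (j <= i) && (u (iter j (@ordS n) y) == 0) by exists 0; rewrite /= uy.
    have ub j : (j <= i) && (u (iter j (@ordS n) y) == 0) -> j <= i by case/andP.
    by case: (ex_maxnP ex ub) => lo h1 h2; exists lo.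
  have [hi /andP[hii /eqP uhi] himin] : exists2 hi, (i + ell < hi) && (u (iter hi (@ordS n) y) == 0) &
     forall j, (i + ell < j) && (u (iter j (@ordS n) y) == 0) -> hi <= j.
    have ex : exists j, (i + ell < j) && (u (iter j (@ordS n) y) == 0).
      by exists n; rewrite iter_ordS_n uy eqxx iN.
    by case: (ex_minnP ex) => hi h1 h2; exists hi.
  have hiN : hi <= n by apply: himin; rewrite iter_ordS_n uy eqxx iN.
  have pos j : lo < j < hi -> 0 < u (iter j (@ordS n) y).
    move=> jlh; rewrite lt0n; apply/eqP => uj.
    have [ji|ij] := leqP j i; first by have := lomax j; rewrite ji uj eqxx => /(_ isT); lia.
    have [jl|lj] := leqP j (i + ell); first by apply: nz; exists j; rewrite ?ij.
    by have := himin j; rewrite lj uj eqxx => /(_ isT); lia.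
  have [m0 [m0n _ fl]] := starts lo ltac:(lia) ulo.
  set k := hi - lo.+1.
  have sa : all (settled tau ini u) (stretch (iter lo (@ordS n) y) k) by apply: st_stretch; lia.
  have ch := settled_chain sa; rewrite ulo fl in ch.
  have kb : ell <= k <= n by lia.
  have kb' : ell <= k < n by lia.
  have := no_full_chain uH kb' m0n _ ch.
  have -> : all (fun x => 0 < u x) (stretch (iter lo (@ordS n) y) k).
    by apply/allP => x /stretchP[j ji ->]; rewrite -iterD; apply: pos; lia.
  move=> /(_ isT).
  have := sparse (iter lo (@ordS n) y) kb; have := flow_stretch sa.
  rewrite fl -iterD {1}/flow -iterS.
  have -> : (k + lo).+1 = hi by lia.
  rewrite uhi /data /particles -map_comp /=.
  have -> : [seq (fst \o site_data tau ini u) x | x <- stretch (iter lo (@ordS n) y) k] =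
    [seq ini x | x <- stretch (iter lo (@ordS n) y) k] by [].
  rewrite /used /=; lia.
(* The nearest zero on the left is within distance [ell], so [low_ell] applies from there; from
   position [ell] on, it is not the sink and m0 = 0. *)
have bnd i : i < n -> exists m0, [/\ m0 <= n, ell <= i -> m0 = 0 &
   lefts (used tau (iter i (@ordS n) y) (u (iter i (@ordS n) y))) <= 16 * ell * (ell + m0) + m0 + ell].
  move=> iN.
  have [lo /andP[loi /eqP ulo] lomax] : exists2 lo, (lo <= i) && (u (iter lo (@ordS n) y) == 0) &
     forall j, (j <= i) && (u (iter j (@ordS n) y) == 0) -> j <= lo.
    have ex : exists j, (j <= i) && (u (iter j (@ordS n) y) == 0) by exists 0; rewrite /= uy.
    have ub j : (j <= i) && (u (iter j (@ordS n) y) == 0) -> j <= i by case/andP.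
    by case: (ex_maxnP ex ub) => lo h1 h2; exists lo.
  have [loE|loN] := eqVneq lo i.
    by exists 0; rewrite -loE ulo.
  have [m0 [m0n m00 fl]] := starts lo ltac:(lia) ulo.
  have near : i - ell <= lo /\ (ell <= i -> 0 < lo).
    have [ie|ei] := ltnP i ell; first by split; lia.
    have [j ji uj] := zero (i - ell) ltac:(lia).
    by have := lomax j; rewrite uj eqxx andbT => /(_ ltac:(lia)); lia.
  exists m0; split => //; first by move=> ei; apply: m00; apply: near.2.
  have sa : all (settled tau ini u) (stretch (iter lo (@ordS n) y) (i - lo).-1) by apply: st_stretch; lia.
  have ch := settled_chain sa; rewrite ulo fl in ch.
  have lr := low_ell uH (_ : (i - lo).-1 <= ell) (_ : (i - lo).-1 < n) m0n ch.
  have iE : iter i (@ordS n) y = iter (i - lo).-1.+1 (@ordS n) (iter lo (@ordS n) y).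
    by rewrite -iterD; congr iter; lia.
  have := chain_lefts sa fl (_ : (i - lo).-1 <= n) iE.
  rewrite ulo => /(_ ltac:(lia)).
  have := lr ltac:(lia) ltac:(lia).
  rewrite {2}/used /=; lia.
exists u; split => //.
- move=> i /andP[ei iN]; apply: quick_visits quick1 _.
  by have [m0 [_ /(_ ei) -> ]] := bnd i iN; nia.
- move=> i iN; apply: quick_visits quick2 _.
  by have [m0 [m0n _]] := bnd i iN; nia.
Qed.

Lemma good_odometer_sum y w : good_odometer y w ->
  \sum_x w x <= n * (B * (17 * ell * ell)) + ell * (B * (17 * ell * (ell + n))).
Proof.
move=> gw.
have inj : {in [pred i : 'I_n | true] &, injective (fun i : 'I_n => iter i (@ordS n) y)}.
  by move=> i j _ _ /iter_ordS_inj h; apply: val_inj; apply: h.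
have inj' : injective (fun i : 'I_n => iter i (@ordS n) y) by move=> i j; apply: inj.
rewrite (reindex_inj inj') /=.
set h1 := B * (17 * ell * ell); set h2 := B * (17 * ell * (ell + n)).
apply: (@leq_trans (\sum_(i < n) (h1 + (i < ell) * h2))).
  apply: leq_sum => i _; have [ie|ei] := ltnP i ell.
    by rewrite mul1n; apply: leq_trans (go_near gw (ltn_ord i)) _; rewrite leq_addl.
  by rewrite mul0n addn0; apply: (go_far gw); rewrite ei ltn_ord.
rewrite big_split /= sum_nat_const card_ord leq_add2l -big_distrl /= leq_mul2r.
apply/orP; right; rewrite -big_mkcond /= -(big_ord_widen n (fun=> 1)); last by lia.
by rewrite sum_nat_const card_ord muln1.
Qed.

(* The odometers u and w are computed with particles frozen at the sinks o and
   y respectively. The glued function is the minimum of both, except on an arc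
   around o, bounded by zeros of w, where it is w; it is stabilizing also at o
   and at y. *)
Lemma subcritical_bound : exists v : 'I_n -> nat,
  \sum_x v x <= n * (B * (17 * ell * ell)) + ell * (B * (17 * ell * (ell + n))) /\
  forall beta, legal tau (fun x => Active (ini x)) beta ->
    forall x, topplings beta x <= v x.
Proof.
have o : 'I_n by apply: (@Ordinal n 0); lia.
have [u gu] := exists_good_odometer o.
(* Taking j beyond [ell] leaves room for a zero of w after o and before y. *)
have [|j jr uj] := go_zero gu (i := ell); first lia.
set y := iter j (@ordS n) o in uj.
have [w gw] := exists_good_odometer y.
exists w; split; first exact: good_odometer_sum gw.
have oE : o = iter (n - j) (@ordS n) y.
  by rewrite /y -iterD subnK ?iter_ordS_n //; lia.
(* Counted from y, the site o is at position n - j. The offsets ensure j1 < n - j < j2, and w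
   vanishes at both ends. *)
have [|j1 j1r w1] := go_zero gw (i := n - j - ell.+1); first lia.
have [|j2 j2r w2] := go_zero gw (i := n - j); first lia.
pose D x := `[< exists2 i, j1 <= i <= j2 & x = iter i (@ordS n) y >].
pose v x := if D x then w x else minn (u x) (w x).
have vw x : v x <= w x by rewrite /v; case: ifP => // _; exact: geq_minr.
have Dy : ~~ D y.
  apply/negP => /asboolP[i ii] /esym/eqP; apply/negP; apply: iter_neq; lia.
have Do : D o by apply/asboolP; exists (n - j) => //; lia.
(* Where v agrees with u' it sends out as much, and it receives no more if v is below u' at both
   neighbors. *)
have mono u' x : v x = u' x -> settled tau ini u' x ->
    v (ordS x) <= u' (ordS x) -> v (ord_pred x) <= u' (ord_pred x) ->
    stabilizing tau ini v x.
  rewrite /stabilizing => -> /andP[_ /eqP ->] h1 h2.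
  rewrite leq_add //; last exact: (leq_count_used tau jumps_left).
  by rewrite leq_add2l; exact: (leq_count_used tau jumps_right).
have stab x : stabilizing tau ini v x.
  have byw : v x = w x -> x != y -> stabilizing tau ini v x.
    by move=> e xy; apply: (mono w) => //; exact: (go_settled gw).
  have [Dx|nDx] := boolP (D x).
    by apply: byw; [rewrite /v Dx | apply: contraNneq Dy => <-].
  have [uw|wu] := leqP (u x) (w x); last first.
    apply: byw; first by rewrite /v (negPf nDx); apply/minn_idPr/ltnW.
    by apply: contraTneq wu => ->; rewrite uj ltn0.
  apply: (mono u).
  - by rewrite /v (negPf nDx); apply/minn_idPl.
  - by apply: (go_settled gu); apply: contraNneq nDx => ->.
  (* If x is outside the arc D and its neighbor is inside, that neighbor is an endpoint of D, where
     w is zero. *)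
  - rewrite {1}/v; case: ifP => [/asboolP[i ii xE]|_]; last exact: geq_minl.
    have [ij|ij] := eqVneq i j1; first by rewrite xE ij w1.
    case/negP: nDx; apply/asboolP; exists i.-1; first by lia.
    by apply: (@ordS_inj n); rewrite xE -iterS prednK //; lia.
  - rewrite {1}/v; case: ifP => [/asboolP[i ii xE]|_]; last exact: geq_minl.
    have [ij|ij] := eqVneq i j2; first by rewrite xE ij w2.
    case/negP: nDx; apply/asboolP; exists i.+1; first by lia.
    by rewrite iterS -xE ord_predK.
move=> beta lb x; apply: leq_trans (vw x).
exact: (least_action stab (progress0 tau ini) _ lb).
Qed.

End Subcritical.

(** * Expected numbers of words and chains *)

Local Open Scope ring_scope.

Fixpoint words (H : nat) : seq word :=
  if H is H'.+1 then
    [::] :: [seq i :: w | i <- [:: Sleep; JumpLeft; JumpRight], w <- words H']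
  else [:: [::]].

Lemma mem_words w H : (size w <= H)%N -> w \in words H.
Proof.
elim: H w => [|H IH] [|i w] //= wH; rewrite inE /= !mem_cat.
by case: i; rewrite map_f ?orbT // IH.
Qed.

Lemma big_words (V : nmodType) H (F : word -> V) :
  \sum_(w <- words H.+1) F w =
  F [::] + (\sum_(w <- words H) F (Sleep :: w) + (\sum_(w <- words H) F (JumpLeft :: w)
  + \sum_(w <- words H) F (JumpRight :: w))).
Proof. by rewrite big_cons /= !big_cat /= !big_map big_nil addr0. Qed.

Section Weights.

Variables (R : realType) (lambda zeta : R).
Hypotheses (lambda_gt0 : 0 < lambda) (zeta_gt0 : 0 < zeta).

Let s : R := lambda / (1 + lambda).
Let p : R := 1 / (2 * (1 + lambda)).

Definition word_mass (w : word) : R := \prod_(i <- w) instruction_pmf lambda i.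

Let p_gt0 : 0 < p. Proof. by rewrite divr_gt0 // mulr_gt0 // addr_gt0. Qed.
Let s_gt0 : 0 < s. Proof. by rewrite divr_gt0 // addr_gt0. Qed.
Let sp : s + 2 * p = 1.
Proof. by rewrite /s /p; field; rewrite gt_eqF // addr_gt0. Qed.

Lemma instruction_pmf_ge0 i : 0 <= instruction_pmf lambda i.
Proof. by case: i; rewrite ltW. Qed.

Lemma word_mass_ge0 w : 0 <= word_mass w.
Proof. by rewrite prodr_ge0 // => i _; exact: instruction_pmf_ge0. Qed.

Lemma word_mass_cons i w : word_mass (i :: w) = instruction_pmf lambda i * word_mass w.
Proof. by rewrite /word_mass big_cons. Qed.

(** As [word_mass w] is the probability that w is a prefix of a stack, this is an expected number of
    prefixes with m left jumps, each weighted by x to its number of right jumps. *)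
Definition left_sum H m (x : R) : R :=
  \sum_(w <- words H) word_mass w * (lefts w == m)%:R * x ^+ rights w.

Lemma left_sumS H m x : left_sum H.+1 m x =
  (m == 0%N)%:R + (s * left_sum H m x + (p * (if m is m'.+1 then left_sum H m' x else 0)
  + p * x * left_sum H m x)).
Proof.
rewrite /left_sum big_words /word_mass big_nil mul1r expr0 mulr1 -/word_mass.
congr (_ + (_ + (_ + _))).
- by case: m.
- by rewrite mulr_sumr; apply: eq_bigr => w _; rewrite big_cons !mulrA.
- case: m => [|m].
    by rewrite mulr0 big1 // => w _; rewrite /= ?andbF mulr0n mulr0 !mul0r.
  by rewrite mulr_sumr; apply: eq_bigr => w _; rewrite big_cons !mulrA.
- rewrite mulr_sumr; apply: eq_bigr => w _; rewrite big_cons /= exprS.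
  by rewrite -/p -/(lefts w) -/(rights w) add0n; ring.
Qed.

(* The bound is the exact value of the sum over all the words. *)
Lemma left_sum_le H m (x y : R) : 0 <= x -> (2 - x) * y = 1 -> 1 <= y ->
  left_sum H m x <= y ^+ m.+1 / p.
Proof.
move=> x0 xy y1; have y0 : 0 <= y by exact: le_trans y1.
have p1 : p <= 1 by have := sp; have := s_gt0; have := p_gt0; lra.
have pN0 : p != 0 by rewrite gt_eqF.
elim: H m => [|H IH] m.
  rewrite /left_sum big_seq1 /word_mass big_nil mul1r expr0 mulr1.
  case: m => [|m]; last by rewrite divr_ge0 ?exprn_ge0 // ltW.
  by rewrite ler_pdivlMr // mul1r (le_trans p1) // exprn_ege1.
rewrite left_sumS.
have -> : y ^+ m.+1 / p = y ^+ m + (s * (y ^+ m.+1 / p) + p * x * (y ^+ m.+1 / p)).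
  have -> : s = 1 - 2 * p by have := sp; lra.
  have -> : y ^+ m = (2 - x) * y ^+ m.+1 by rewrite exprS mulrA xy mul1r.
  by field.
have h1 : s * left_sum H m x <= s * (y ^+ m.+1 / p) by rewrite ler_pM2l.
have h2 : p * x * left_sum H m x <= p * x * (y ^+ m.+1 / p).
  by rewrite ler_wpM2l // mulr_ge0 // ltW.
have h3 : (m == 0%N)%:R + p * (if m is m'.+1 then left_sum H m' x else 0) <= y ^+ m.
  case: m {h1 h2} => [|m] /=; first by rewrite mulr0 addr0 expr0.
  by rewrite add0r mulrC -ler_pdivlMr.
by lra.
Qed.

Definition tail_sum H m (x : R) : R :=
  \sum_(w <- words H) word_mass w * (~~ ends_asleep w && (lefts w == m))%:R * x ^+ rights w.

(** A nonempty word counted here ends with a jump, whose probability p cancels the factor 1 / p of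
    [left_sum_le]. As y = 1 / (2 - x), the total is y ^ m + x y ^ (m + 1) = 2 y ^ (m + 1). *)
Lemma tail_sum_le H m (x y : R) : 0 <= x -> (2 - x) * y = 1 -> 1 <= y ->
  tail_sum H m x <= 2 * y ^+ m.+1.
Proof.
move=> x0 xy y1; have y0 : 0 <= y by exact: le_trans y1.
have pN0 : p != 0 by rewrite gt_eqF.
have e1 k : 1 <= y ^+ k by rewrite exprn_ege1.
case: H => [|H].
  rewrite /tail_sum big_seq1 /word_mass big_nil mul1r expr0 mulr1 /=.
  by have := e1 m.+1; case: (_ == _); rewrite /=; lra.
have -> : tail_sum H.+1 m x =
  (m == 0%N)%:R + (p * (if m is m'.+1 then left_sum H m' x else 0)
  + p * x * left_sum H m x).
  rewrite /tail_sum /left_sum big_words /word_mass big_nil mul1r expr0 mulr1 -/word_mass.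
  rewrite -[X in _ = _ + X]add0r; congr (_ + (_ + (_ + _))).
  - by case: m.
  - by rewrite big1 // => w _; rewrite /= mulr0 mul0r.
  - case: m => [|m].
    by rewrite mulr0 big1 // => w _; rewrite /= ?andbF mulr0n mulr0 !mul0r.
    by rewrite mulr_sumr; apply: eq_bigr => w _; rewrite big_cons !mulrA.
  - rewrite mulr_sumr; apply: eq_bigr => w _; rewrite big_cons /= exprS.
    by rewrite -/p -/(lefts w) -/(rights w) add0n; ring.
have -> : 2 * y ^+ m.+1 = y ^+ m + p * x * (y ^+ m.+1 / p).
  have -> : y ^+ m = (2 - x) * y ^+ m.+1 by rewrite exprS mulrA xy mul1r.
  by field.
have h2 : p * x * left_sum H m x <= p * x * (y ^+ m.+1 / p).
  by rewrite ler_wpM2l ?left_sum_le // mulr_ge0 // ltW.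
rewrite addrA lerD //.
case: m {h2} => [|m] /=; first by rewrite mulr0 addr0 expr0.
by rewrite add0r mulrC -ler_pdivlMr // left_sum_le.
Qed.

Definition site_weight (alpha beta eps : R) (w : word) : R :=
  if w is [::] then eps else if ends_asleep w then alpha else beta.

(** Removing the last instruction leaves a word that does not end asleep, so [tail_sum_le] applies.
    The two kinds of jumps give 2 p beta (y ^ m + x y ^ (m + 1)) = 4 p beta y ^ (m + 1). *)
Lemma site_sum_le H m (alpha beta eps x y : R) :
  0 <= alpha -> 0 <= beta -> 0 <= eps ->
  0 <= x -> (2 - x) * y = 1 -> 1 <= y ->
  \sum_(w <- words H) word_mass w * (admissible w && (lefts w == m))%:R *
     site_weight alpha beta eps w * x ^+ rights w <=
  (2 * s * alpha + 4 * p * beta + eps) * y ^+ m.+1.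
Proof.
move=> a0 b0 c0 x0 xy y1; have y0 : 0 <= y by exact: le_trans y1.
have e1 k : 1 <= y ^+ k by rewrite exprn_ege1.
have s0 := ltW s_gt0; have p0 := ltW p_gt0.
have ye : 0 <= y ^+ m.+1 by rewrite exprn_ge0.
case: H => [|H].
  rewrite big_seq1 /word_mass big_nil /= mul1r expr0 mulr1.
  apply: (@le_trans _ _ eps).
    by case: (_ == _); rewrite ?mul1r ?mul0r.
  rewrite -[leLHS]mulr1; apply: ler_pM => //.
  by have := mulr_ge0 s0 a0; have := mulr_ge0 p0 b0; lra.
rewrite big_words /word_mass big_nil mul1r expr0 mulr1 -/word_mass /=.
have -> : \sum_(w <- words H) word_mass (Sleep :: w) *
   (admissible (Sleep :: w) && (lefts (Sleep :: w) == m))%:R * alpha * x ^+ rights (Sleep :: w)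
   = s * alpha * tail_sum H m x.
  by rewrite mulr_sumr; apply: eq_bigr => w _; rewrite /word_mass big_cons /= -/s !add0n -/(lefts w) -/(rights w) /admissible /=; ring.
have -> : \sum_(w <- words H) word_mass (JumpLeft :: w) *
   (admissible (JumpLeft :: w) && (lefts (JumpLeft :: w) == m))%:R * beta * x ^+ rights (JumpLeft :: w)
   = p * beta * (if m is m'.+1 then tail_sum H m' x else 0).
  case: m {ye} => [|m]; first by rewrite mulr0 big1 // => w _; rewrite /= andbF mulr0 !mul0r.
  by rewrite mulr_sumr; apply: eq_bigr => w _; rewrite /word_mass big_cons /= -/p !add0n -/(lefts w) -/(rights w) /admissible /= add1n eqSS; ring.
have -> : \sum_(w <- words H) word_mass (JumpRight :: w) *
   (admissible (JumpRight :: w) && (lefts (JumpRight :: w) == m))%:R * beta * x ^+ rights (JumpRight :: w)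
   = p * beta * x * tail_sum H m x.
  rewrite mulr_sumr; apply: eq_bigr => w _; rewrite /word_mass big_cons /= -/p exprS.
  by rewrite -/(lefts w) -/(rights w) add0n /admissible /=; ring.
have t1 := tail_sum_le H m x0 xy y1.
have t2 : (if m is m'.+1 then tail_sum H m' x else 0) <= 2 * y ^+ m.
  case: m {ye t1} => [|m]; first by rewrite mulr_ge0 // ltW.
  exact: tail_sum_le.
have h1 : s * alpha * tail_sum H m x <= s * alpha * (2 * y ^+ m.+1).
  by rewrite ler_wpM2l // mulr_ge0.
have h3 : p * beta * x * tail_sum H m x <= p * beta * x * (2 * y ^+ m.+1).
  by rewrite ler_wpM2l // mulr_ge0 // mulr_ge0.
have h2 : p * beta * (if m is m'.+1 then tail_sum H m' x else 0) <= p * beta * (2 * y ^+ m).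
  by rewrite ler_wpM2l // mulr_ge0.
have h4 : (0%N == m)%:R * eps <= eps * y ^+ m.+1.
  by rewrite mulrC ler_wpM2l //; case: (0%N == m); rewrite ?e1 // exprn_ge0.
have ym : y ^+ m = (2 - x) * y ^+ m.+1 by rewrite exprS mulrA xy mul1r.
rewrite ym in h2.
apply: le_trans (lerD h4 (lerD h1 (lerD h2 h3))) _.
by rewrite le_eqVlt; apply/orP; left; apply/eqP; ring.
Qed.

End Weights.

(** * Finite sums over the data of consecutive sites *)

Definition atoms (M H : nat) : seq (nat * word) :=
  [seq (k, w) | k <- iota 0 M, w <- words H].

Fixpoint samples (M H k : nat) : seq (seq (nat * word)) :=
  if k is k'.+1 then [seq a :: l | a <- atoms M H, l <- samples M H k'] else [:: [::]].

Lemma size_samples M H k l : l \in samples M H k -> size l = k.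
Proof.
elim: k l => [|k IH] l /=; first by rewrite inE => /eqP ->.
by case/allpairsP => -[a l'] /= [_ /IH <- ->].
Qed.

Lemma mem_samples M H l : all (fun a => (a.1 < M)%N && (size a.2 <= H)%N) l ->
  l \in samples M H (size l).
Proof.
elim: l => [|[j w] l IH] //= /andP[/andP[jM wH] /IH lin].
apply/allpairsP; exists ((j, w), l); split => //=.
by apply/allpairsP; exists (j, w); rewrite mem_iota mem_words.
Qed.

Section Samples.

Variables (R : realType) (lambda zeta : R).
Hypotheses (lambda_gt0 : 0 < lambda) (zeta_gt0 : 0 < zeta).

Definition mass (l : seq (nat * word)) : R :=
  \prod_(a <- l) (poisson_pmf zeta a.1 * word_mass lambda a.2).

(** Not a probability in general: all the prefixes of a stack are counted, so an indicator F gives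
    an expected number of samples, as in a union bound. With H = 0 only the particle numbers
    matter. *)
Definition expect M H k (F : seq (nat * word) -> R) : R :=
  \sum_(l <- samples M H k) mass l * F l.

Lemma mass_ge0 l : 0 <= mass l.
Proof.
by rewrite prodr_ge0 // => a _; rewrite mulr_ge0 ?poisson_pmf_ge0 ?word_mass_ge0.
Qed.

Lemma expect0 M H F : expect M H 0 F = F [::].
Proof. by rewrite /expect /= big_seq1 /mass big_nil mul1r. Qed.

Lemma expectS M H k F : expect M H k.+1 F =
  \sum_(j <- iota 0 M) poisson_pmf zeta j *
    \sum_(w <- words H) word_mass lambda w * expect M H k (fun l => F ((j, w) :: l)).
Proof.
rewrite /expect /= big_allpairs_dep big_allpairs /=; apply: eq_bigr => j _.
rewrite mulr_sumr; apply: eq_bigr => w _; rewrite !mulr_sumr.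
by apply: eq_bigr => l _; rewrite /mass big_cons /= !mulrA.
Qed.

Lemma le_expect M H k F G :
  (forall l, size l = k -> F l <= G l) -> expect M H k F <= expect M H k G.
Proof.
move=> FG; rewrite /expect big_seq [leRHS]big_seq; apply: ler_sum => l /size_samples lk.
by rewrite ler_wpM2l ?mass_ge0 // FG.
Qed.

Lemma expectZ M H k c F : expect M H k (fun l => c * F l) = c * expect M H k F.
Proof. by rewrite /expect mulr_sumr; apply: eq_bigr => l _; rewrite mulrCA. Qed.

Lemma sum_poisson_le M z : 0 <= z ->
  \sum_(j <- iota 0 M) poisson_pmf zeta j * z ^+ j <= expR (zeta * (z - 1)).
Proof.
move=> z0; have -> : zeta * (z - 1) = zeta * z - zeta by ring.
rewrite expRD.
have -> : \sum_(j <- iota 0 M) poisson_pmf zeta j * z ^+ j =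
    series (exp_coeff (zeta * z)) M * expR (- zeta).
  rewrite /series /= /index_iota subn0 mulr_suml; apply: eq_bigr => j _.
  by rewrite /poisson_pmf zeta_gt0 /exp_coeff /= exprMn; ring.
rewrite ler_wpM2r ?expR_ge0 // /expR.
apply: nondecreasing_cvgn_le; last exact: is_cvg_series_exp_coeff.
apply: nondecreasing_series => j _ _; apply: exp_coeff_ge0.
by rewrite mulr_ge0 // ltW.
Qed.

Lemma sum_poisson_le1 M : \sum_(j <- iota 0 M) poisson_pmf zeta j <= 1.
Proof.
have := sum_poisson_le M ler01; rewrite subrr mulr0 expR0.
by under eq_bigr do rewrite expr1n mulr1.
Qed.

Definition weight (psi : word -> R) (l : seq (nat * word)) : R := \prod_(a <- l) psi a.2.

(* c i is the base of the weight c i ^+ R when i sites remain to be explored. *)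
Lemma expect_chain_le M H k D r f (psi : word -> R) (c : nat -> R) (C E : R) :
  (forall w, 0 <= psi w) -> 0 <= C -> (forall i, (i <= k)%N -> 1 <= c i) ->
  (forall i, (i <= k)%N -> c i ^+ D <= E) ->
  (forall i m, (i < k)%N -> \sum_(w <- words H) word_mass lambda w *
     (admissible w && (lefts w == m))%:R * psi w * c i ^+ rights w <= C * c i.+1 ^+ m) ->
  (k%:Z - f <= D%:Z)%R ->
  expect M H k (fun l => (chain r f l)%:R * weight psi l * c 0%N ^+ last_rights r l)
    <= (C * E) ^+ k * c k ^+ r.
Proof.
move=> psi0 C0; elim: k r f => [|k IH] r f c1 cD site kfD.
  by rewrite expect0 /weight big_nil expr0 !mul1r.
have E1 : 1 <= E by apply: le_trans (cD 0%N _) => //; rewrite exprn_ege1 // c1.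
have CE0 : 0 <= C * E by rewrite mulr_ge0 // (le_trans _ E1).
rewrite expectS.
pose K := (C * E) ^+ k.+1 * c k.+1 ^+ r.
have K0 : 0 <= K by rewrite mulr_ge0 ?exprn_ge0 // (le_trans _ (c1 k.+1 _)).
(* The bound does not depend on the initial number j of particles, so it is enough that the Poisson
   weights sum to at most 1. *)
suff inner j : \sum_(w <- words H) word_mass lambda w * expect M H k (fun l =>
    (chain r f ((j, w) :: l))%:R * weight psi ((j, w) :: l) *
    c 0%N ^+ last_rights r ((j, w) :: l)) <= K.
  apply: (@le_trans _ _ (\sum_(j <- iota 0 M) poisson_pmf zeta j * K)).
    by apply: ler_sum => j _; rewrite ler_wpM2l ?poisson_pmf_ge0 //.
  rewrite -mulr_suml -[leRHS]mul1r ler_wpM2r //; exact: sum_poisson_le1.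
have [[m rE]|neg] : {m : nat | r%:Z - f = m%:Z} + {(r%:Z - f < 0)%R}.
- by case: (r%:Z - f)%R => m; [left; exists m | right].
(* The flow drops by at most one per site, so the hypothesis on k - f persists along the chain. It
   gives m <= r + D, and the excess over r costs at most E. *)
- have mD : (m <= r + D)%N by lia.
  apply: (@le_trans _ _ (\sum_(w <- words H) word_mass lambda w *
     (admissible w && (lefts w == m))%:R * psi w * c k ^+ rights w * (C * E) ^+ k)).
    apply: ler_sum => w _; rewrite -!mulrA ler_wpM2l ?word_mass_ge0 //.
    have -> : expect M H k (fun l =>
        (chain r f ((j, w) :: l))%:R * weight psi ((j, w) :: l) *
        c 0%N ^+ last_rights r ((j, w) :: l)) =
      (admissible w && (lefts w == m))%:R * psi w *
      expect M H k (fun l => (chain (rights w) (f + j%:Z - (ends_asleep w)%:Z) l)%:R *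
        weight psi l * c 0%N ^+ last_rights (rights w) l).
      rewrite -expectZ; congr expect; apply/funext => l /=.
      rewrite /weight big_cons /= /last_rights /=.
      have -> : ((lefts w)%:Z + f == r%:Z) = (lefts w == m) by lia.
      by case: admissible; case: (_ == m); rewrite /= ?mul0r // ?mul1r; ring.
    rewrite -!mulrA ler_wpM2l // ler_wpM2l // mulrC.
    apply: IH => [i ik|i ik|i m' ik|]; [exact/c1/leqW|exact/cD/leqW|exact/site/leqW|].
    by case: ends_asleep; lia.
  rewrite -mulr_suml.
  apply: (@le_trans _ _ (C * c k.+1 ^+ m * (C * E) ^+ k)).
    by rewrite ler_wpM2r ?exprn_ge0 // site.
  rewrite /K exprS -!mulrA ler_wpM2l //.
  rewrite [leLHS]mulrC mulrCA ler_wpM2l ?exprn_ge0 // mulrC.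
  apply: (@le_trans _ _ (c k.+1 ^+ (r + D))).
    by rewrite ler_weXn2l // c1.
  by rewrite exprD ler_wpM2l ?cD // exprn_ge0 // (le_trans _ (c1 k.+1 _)).
- rewrite big1 // => w _; rewrite /expect big1 ?mulr0 // => l _ /=.
  have -> : ((lefts w)%:Z + f == r%:Z) = false by lia.
  by rewrite andbF !mul0r mulr0.
Qed.

Lemma weight_ge0 psi l : (forall w, 0 <= psi w) -> 0 <= weight psi l.
Proof. by move=> psi0; rewrite prodr_ge0. Qed.

Lemma site_weight_ge0 (a b e : R) w : 0 <= a -> 0 <= b -> 0 <= e -> 0 <= site_weight a b e w.
Proof. by case: w => //= i w; case: is_sleep. Qed.

(** The base 1 is the fixed point of x -> 1 / (2 - x), so x = y = 1 works at every site and the flow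
    costs nothing. *)
Lemma expect_chain_flat M H k r f (a b e : R) : 0 <= a -> 0 <= b -> 0 <= e ->
  expect M H k (fun l => (chain r f l)%:R * weight (site_weight a b e) l) <=
  (2 * (lambda / (1 + lambda)) * a + 4 * (1 / (2 * (1 + lambda))) * b + e) ^+ k.
Proof.
move=> a0 b0 e0; set C := (2 * _ * a + _ + e).
have l1 : 0 < 1 + lambda by rewrite addr_gt0.
have C0 : 0 <= C.
  by rewrite !addr_ge0 // !mulr_ge0 // ?invr_ge0 ?mulr_ge0 // ltW.
pose D := `|k%:Z - f|%N.
have -> : (fun l => (chain r f l)%:R * weight (site_weight a b e) l) =
    (fun l => (chain r f l)%:R * weight (site_weight a b e) l * (fun=> 1) 0%N ^+ last_rights r l).
  by apply/funext => l; rewrite expr1n mulr1.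
have -> : C ^+ k = (C * 1) ^+ k * (fun=> 1) k ^+ r by rewrite expr1n !mulr1.
apply: (@expect_chain_le M H k D r f _ (fun=> 1) C 1) => //.
- by move=> w; exact: site_weight_ge0.
- move=> i m ik; have := @site_sum_le R lambda lambda_gt0 H m a b e 1 1 a0 b0 e0.
  by rewrite !expr1n; apply => //; ring.
- by rewrite /D; lia.
Qed.

Lemma expect_particles_le M k z : 0 <= z ->
  expect M 0 k (fun l => z ^+ particles l) <= expR (zeta * (z - 1)) ^+ k.
Proof.
move=> z0; elim: k => [|k IH]; first by rewrite expect0 expr0.
rewrite expectS exprS.
apply: (@le_trans _ _ (\sum_(j <- iota 0 M) poisson_pmf zeta j * z ^+ j * expR (zeta * (z - 1)) ^+ k)).
  apply: ler_sum => j _; rewrite -mulrA ler_wpM2l ?poisson_pmf_ge0 //.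
  rewrite big_seq1 /word_mass big_nil mul1r.
  rewrite /particles /=; under eq_fun do rewrite exprD.
  by rewrite expectZ ler_wpM2l ?exprn_ge0.
by rewrite -mulr_suml ler_wpM2r ?exprn_ge0 ?expR_ge0 // sum_poisson_le.
Qed.

Lemma sum_words_size H z :
  \sum_(w <- words H) word_mass lambda w * ((size w == H)%:R * z ^+ lefts w) =
  (1 - (1 - z) / (2 * (1 + lambda))) ^+ H.
Proof.
have l1 : 1 + lambda != 0 by rewrite gt_eqF // addr_gt0.
elim: H => [|H IH]; first by rewrite big_seq1 /word_mass big_nil /= !mul1r !expr0.
rewrite big_words /= mul0r mulr0 add0r exprS -IH !mulr_sumr -!big_split /=.
apply: eq_bigr => w _; rewrite !word_mass_cons /= eqSS -/(lefts w) !add0n exprS.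
by field.
Qed.

End Samples.

(** * Exponential bounds for chains, particle numbers and stacks *)

Section Estimates.

Variables (R : realType) (lambda zeta : R).
Hypotheses (lambda_gt0 : 0 < lambda) (zeta_gt0 : 0 < zeta).

Notation expect := (@expect R lambda zeta).

Lemma weight_sleepers (a : R) l :
  weight (site_weight a 1 1) l = a ^+ sleepers l.
Proof.
elim: l => [|[j w] l IH]; first by rewrite /weight big_nil.
rewrite /weight big_cons -/(weight _ _) IH /sleepers /= exprD.
by case: w => [|[] w] /=; rewrite ?expr1 ?expr0 ?mul1r.
Qed.

(** The weight 1 / lambda on words ending asleep cancels their factor lambda, so each site
    contributes at most 4 + 1; Markov's inequality then yields lambda ^ c. *)
Lemma expect_asleep_chain M H k r f c : lambda <= 1 ->
  expect M H k (fun l => (chain r f l && (c <= sleepers l)%N)%:R) <= 5 ^+ k * lambda ^+ c.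
Proof.
move=> l1.
have lV : 1 <= lambda^-1 by rewrite invf_ge1.
have l0 : 0 < lambda^-1 by rewrite invr_gt0.
apply: (@le_trans _ _ (expect M H k (fun l => lambda ^+ c *
   ((chain r f l)%:R * weight (site_weight lambda^-1 1 1) l)))).
  apply: le_expect => // l _; rewrite weight_sleepers.
  case: chain; rewrite /= ?mul0r ?mulr0 // mul1r.
  case: leqP => cl /=; last by rewrite mulr_ge0 ?exprn_ge0 ?ltW // invr_gt0.
  by rewrite exprVn ler_pdivlMr ?exprn_gt0 // mul1r ler_wiXn2l // ltW.
rewrite expectZ mulrC ler_wpM2r ?exprn_ge0 ?(ltW lambda_gt0) //.
apply: le_trans (expect_chain_flat lambda_gt0 zeta_gt0 M H k r f (ltW l0) ler01 ler01) _.
have l1' : 0 < 1 + lambda by rewrite addr_gt0.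
apply: lerXn2r; rewrite ?nnegrE //.
  by rewrite !addr_ge0 // !mulr_ge0 // ?invr_ge0 ?mulr_ge0 // ltW.
have -> : 2 * (lambda / (1 + lambda)) * lambda^-1 + 4 * (1 / (2 * (1 + lambda))) * 1 + 1
   = 4 / (1 + lambda) + 1 by field; rewrite !gt_eqF.
have : 4 / (1 + lambda) <= 4 by rewrite ler_pdivrMr // ler_peMr // lerDl ltW.
lra.
Qed.

(** Give weight 0 to empty words and 1 + lambda to words ending with a jump, cancelling their factor
    1 / (1 + lambda): each site contributes at most 4, and at least k - d words end with a jump. *)
Lemma expect_full_chain M H k r f d :
  expect M H k (fun l => [&& chain r f l, all (fun a => 0 < size a.2)%N l & (sleepers l <= d)%N]%:R)
  <= 4 ^+ k * (1 + lambda) ^- (k - d).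
Proof.
have l1 : 0 < 1 + lambda by rewrite addr_gt0.
have l1' : 1 <= 1 + lambda by rewrite lerDl ltW.
have psi0 w : 0 <= site_weight 1 (1 + lambda) 0 w by rewrite site_weight_ge0 // ltW.
apply: (@le_trans _ _ (expect M H k (fun l => (1 + lambda) ^- (k - d) *
   ((chain r f l)%:R * weight (site_weight 1 (1 + lambda) 0) l)))).
  apply: le_expect => // l lk.
  case: chain; rewrite /= ?mul0r ?mulr0 // mul1r.
  case: (boolP (all _ l)) => /= [al|_]; last first.
    by rewrite mulr_ge0 ?invr_ge0 ?exprn_ge0 ?weight_ge0 // ltW.
  case: leqP => dl /=; last first.
    by rewrite mulr_ge0 ?invr_ge0 ?exprn_ge0 ?weight_ge0 // ltW.
  have -> : weight (site_weight 1 (1 + lambda) 0) l = (1 + lambda) ^+ (size l - sleepers l).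
    elim: l al {lk dl} => [|[j w] l IH] /=; first by rewrite /weight big_nil.
    move=> /andP[w0 /IH {}IH]; rewrite /weight big_cons -/(weight _ _) IH /sleepers /=.
    case: w w0 => [|[] w] //= _; first by rewrite mul1r.
    - by rewrite -exprS subSn // count_size.
    - by rewrite -exprS subSn // count_size.
  rewrite mulrC ler_pdivlMr ?exprn_gt0 // mul1r lk.
  by rewrite ler_weXn2l // leq_sub2l.
rewrite expectZ mulrC ler_wpM2r ?invr_ge0 ?exprn_ge0 ?(ltW l1) //.
apply: le_trans (expect_chain_flat lambda_gt0 zeta_gt0 M H k r f ler01 (ltW l1) (lexx _)) _.
apply: lerXn2r; rewrite ?nnegrE //.
  by rewrite !addr_ge0 // !mulr_ge0 // ?invr_ge0 ?mulr_ge0 // ltW.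
have -> : 2 * (lambda / (1 + lambda)) * 1 + 4 * (1 / (2 * (1 + lambda))) * (1 + lambda) + 0
   = 2 * (lambda / (1 + lambda)) + 2 by field; rewrite !gt_eqF.
have : lambda / (1 + lambda) <= 1 by rewrite ler_pdivrMr // mul1r lerDr.
lra.
Qed.

Lemma expR1_le3 : expR 1 <= 3 :> R.
Proof.
have h : expR (8%:R^-1) <= 8 / 7 :> R.
  have := expR_ge1Dx (- 8%:R^-1 : R); rewrite expRN => h.
  have e0 := expR_gt0 (8%:R^-1 : R).
  rewrite -[leLHS]invrK -[leRHS]invrK lef_pV2 ?posrE ?invr_gt0 //; lra.
have -> : 1 = 8%:R * 8%:R^-1 :> R by field.
rewrite expRM_natl; apply: (@le_trans _ _ ((8 / 7) ^+ 8)).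
  by apply: lerXn2r; rewrite ?nnegrE // expR_ge0.
lra.
Qed.

(* Exploring a site with base 1 + 1 / t for the right jumps gives base
   1 + 1 / (t - 1) for the left jumps; t decreases from 2 b to b. *)
Lemma expect_high_chain M H k b m0 : (0 < b)%N -> (k <= b)%N ->
  expect M H k (fun l => (chain 0 (- m0%:Z) l && (16 * b * (b + m0) <= last_rights 0 l)%N)%:R)
  <= expR (- b%:R).
Proof.
move=> b0 kb; pose D := (b + m0)%N.
pose c (i : nat) : R := 1 + ((2 * b - i)%N)%:R^-1.
pose E : R := (1 + b%:R^-1) ^+ D.
have bR : 0 < b%:R :> R by rewrite ltr0n.
have cge1 i : 1 <= c i by rewrite lerDl invr_ge0.
have cb i : (i <= k)%N -> c i <= 1 + b%:R^-1.
  by move=> ik; rewrite lerD2l lef_pV2 ?posrE ?ltr0n ?ler_nat; lia.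
have c0 : 0 < c 0%N by rewrite (lt_le_trans _ (cge1 _)).
have mk : expect M H k (fun l => (chain 0 (- m0%:Z) l)%:R * weight (fun=> 1) l
     * c 0%N ^+ last_rights 0 l) <= (6 * E) ^+ k * c k ^+ 0.
  apply: (@expect_chain_le R lambda zeta lambda_gt0 zeta_gt0 M H k D) => //.
  - by move=> i ik; rewrite /E lerXn2r ?nnegrE ?cb // (le_trans _ (cge1 _)).
  - move=> i m ik.
    have ik2 : (i.+1 < 2 * b)%N by lia.
    pose t : R := (2 * b - i.+1)%N%:R.
    have t1 : 1 <= t by rewrite /t ler1n; lia.
    have cS : c i.+1 = 1 + t^-1 by [].
    have ci : c i = 1 + (t + 1)^-1.
      by rewrite /c /t natr1; congr (1 + (_ %:R)^-1); lia.
    have tinv : 0 <= t^-1 <= 1 by rewrite invr_ge0 invf_le1 ?(lt_le_trans _ t1) // t1 (le_trans _ t1).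
    have := @site_sum_le R lambda lambda_gt0 H m 1 1 1 (c i) (c i.+1) ler01 ler01 ler01.
    have -> : 0 <= c i by rewrite (le_trans _ (cge1 _)).
    have -> : (2 - c i) * c i.+1 = 1.
      by rewrite ci cS; field; rewrite !gt_eqF //; lra.
    move=> /(_ isT erefl (cge1 _)).
    have -> : 2 * (lambda / (1 + lambda)) * 1 + 4 * (1 / (2 * (1 + lambda))) * 1 + 1 = 3 :> R.
      by field; rewrite gt_eqF // addr_gt0.
    (* The bases are at most 2, so the extra power in [site_sum_le] turns 3 into 6. *)
    move=> h; apply: le_trans (_ : 3 * c i.+1 ^+ m.+1 <= _).
      apply: le_trans h; rewrite le_eqVlt; apply/orP; left; apply/eqP.
      apply: eq_bigr => w _; congr (_ * _ * _ * _).
      by case: w => //= a w; case: is_sleep.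
    rewrite exprS mulrA ler_wpM2r ?exprn_ge0 // ?(le_trans _ (cge1 _)) //.
    by rewrite cS; lra.
  - by rewrite /D; lia.
(* Markov's inequality at the threshold. By Bernoulli, (1 + 1 / (2 b)) ^ (2 b) >= 2, so T >= 2 ^ (8
   D), while the weighted sum is at most (6 e) ^ D; then 6 e <= 256 / e since e <= 3. *)
pose T : R := c 0%N ^+ (16 * b * (b + m0)).
have T0 : 0 < T by rewrite exprn_gt0.
apply: (@le_trans _ _ (expect M H k (fun l => T^-1 * ((chain 0 (- m0%:Z) l)%:R *
    weight (fun=> 1) l * c 0%N ^+ last_rights 0 l)))).
  apply: le_expect => // l _.
  case: chain; rewrite /= ?mul0r ?mulr0 // mul1r.
  have -> : weight (fun=> 1) l = 1 :> R by rewrite /weight big1.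
  rewrite mul1r; case: leqP => hl /=; last by rewrite mulr_ge0 ?invr_ge0 ?exprn_ge0 // ltW.
  by rewrite mulrC ler_pdivlMr // mul1r ler_weXn2l.
rewrite expectZ; apply: (@le_trans _ _ (T^-1 * ((6 * E) ^+ k * c k ^+ 0))).
  by rewrite ler_wpM2l // invr_ge0 ltW.
rewrite expr0 mulr1 mulrC ler_pdivrMr //.
have E1 : 1 <= E by rewrite exprn_ege1 // lerDl invr_ge0 ltW.
have hE : E ^+ k <= expR 1 ^+ D.
  apply: (@le_trans _ _ (E ^+ b)); first by rewrite ler_weXn2l.
  have nn : 0 <= 1 + b%:R^-1 :> R by rewrite addr_ge0 // invr_ge0 ltW.
  rewrite /E -exprM mulnC exprM; apply: lerXn2r; rewrite ?nnegrE ?exprn_ge0 ?expR_ge0 //.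
  have -> : expR 1 = expR (b%:R^-1) ^+ b :> R by rewrite -expRM_natl mulfV // gt_eqF.
  by apply: lerXn2r; rewrite ?nnegrE ?expR_ge0 //; exact: expR_ge1Dx.
have hT : 256 ^+ D <= T.
  have -> : T = (c 0%N ^+ (2 * b)) ^+ (8 * D) by rewrite -exprM /T /D; congr (_ ^+ _); lia.
  have -> : 256 = 2 ^+ 8 :> R by ring.
  rewrite -[leLHS]exprM; apply: lerXn2r; rewrite ?nnegrE ?exprn_ge0 ?(ltW c0) //.
  have B0 : 0 < (2 * b)%N%:R :> R by rewrite ltr0n; lia.
  have bern n' (a : R) : 0 <= a -> 1 + n'%:R * a <= (1 + a) ^+ n'.
    move=> a0; elim: n' => [|n' IH]; first by rewrite mul0r addr0 expr0.
    rewrite exprS; apply: le_trans (ler_wpM2l (_ : 0 <= 1 + a) IH); last by rewrite addr_ge0.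
    rewrite -natr1; have := mulr_ge0 (ler0n R n') (mulr_ge0 a0 a0); lra.
  have := bern (2 * b)%N ((2 * b - 0)%N%:R^-1) _.
  by rewrite subn0 mulfV ?gt_eqF // /c subn0 invr_ge0 ler0n => /(_ isT).
have h6 : 6 ^+ k <= 6 ^+ D :> R by rewrite ler_weXn2l ?ler1n // (leq_trans kb) // leq_addr.
apply: (@le_trans _ _ (expR (- b%:R) * 256 ^+ D)); last first.
  by rewrite ler_wpM2l // expR_ge0.
apply: (@le_trans _ _ (expR (- D%:R) * 256 ^+ D)); last first.
  by rewrite ler_wpM2r ?exprn_ge0 // ler_expR lerN2 ler_nat /D leq_addr.
rewrite expRN -[D%:R]mulr1 expRM_natl exprMn.
apply: (@le_trans _ _ (6 ^+ D * expR 1 ^+ D)).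
  by apply: ler_pM => //; rewrite exprn_ge0 // (le_trans _ E1).
have e0 : 0 < expR 1 ^+ D :> R by rewrite exprn_gt0 // expR_gt0.
rewrite [leRHS]mulrC ler_pdivlMr // -!exprMn; apply: lerXn2r; rewrite ?nnegrE ?mulr_ge0 ?expR_ge0 //.
have e1 := expR_ge0 (1 : R).
have := ler_pM e1 e1 expR1_le3 expR1_le3; lra.
Qed.

Lemma expect_crowded (theta : R) : zeta < theta -> exists2 c : R, 0 < c &
  forall M k, expect M 0 k (fun l => (theta * k%:R < (particles l)%:R)%R%:R) <= expR (- (c * k%:R)).
Proof.
move=> zt; have t0 : 0 < theta by exact: lt_trans zt.
pose q := zeta / theta; have q1 : q < 1 by rewrite ltr_pdivrMr // mul1r.
have q0 : 0 < q by rewrite divr_gt0.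
(* Chernoff parameter: e ^ t <= 1 / (1 - t) and 1 - t = (1 + q) / 2 > q make the rate positive. *)
pose t : R := (1 - q) / 2.
have t_gt0 : 0 < t by rewrite /t; lra.
have et : expR t <= (1 - t)^-1.
  have := expR_ge1Dx (- t); rewrite expRN => h.
  by rewrite -[leLHS]invrK lef_pV2 ?posrE ?invr_gt0 ?expR_gt0 //; rewrite /t; lra.
exists (theta * t - zeta * (expR t - 1)).
  rewrite subr_gt0; apply: (@le_lt_trans _ _ (zeta * ((1 - t)^-1 - 1))).
    by rewrite ler_wpM2l ?lerD2r // ltW.
  have -> : zeta = q * theta by rewrite /q divfK // gt_eqF.
  have -> : (1 - t)^-1 - 1 = t / (1 - t) by field; rewrite gt_eqF // /t; lra.
  rewrite [q * _]mulrC -mulrA ltr_pM2l // mulrA ltr_pdivrMr; last by rewrite /t; lra.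
  rewrite mulrC ltr_pM2l // /t; lra.
move=> M k; apply: (@le_trans _ _ (expect M 0 k (fun l => expR (- (theta * t * k%:R)) *
    expR t ^+ particles l))).
  apply: le_expect => // l _; rewrite -expRM_natr -expRD.
  case: ltP => h /=; last exact: expR_ge0.
  rewrite -[leLHS]expR0 ler_expR addrC subr_ge0.
  have := ler_wpM2l (ltW t_gt0) (ltW h). lra.
rewrite expectZ; apply: (@le_trans _ _ (expR (- (theta * t * k%:R)) * expR (zeta * (expR t - 1)) ^+ k)).
  by rewrite ler_wpM2l ?expR_ge0 // expect_particles_le // expR_ge0.
by rewrite -expRM_natr -expRD ler_expR; lra.
Qed.

Lemma expect_scarce : exists2 c : R, 0 < c &
  forall M k, expect M 0 k (fun l => ((particles l)%:R < zeta / 2 * k%:R)%R%:R) <= expR (- (c * k%:R)).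
Proof.
have e2 : expR (-1) < 2^-1 :> R.
  rewrite expRN ltf_pV2 ?posrE ?expR_gt0 //.
  by have := expR_gt1Dx (oner_neq0 R); lra.
(* Chernoff bound with parameter -1; the rate is positive because e > 2. *)
exists (zeta * (2^-1 - expR (-1))); first by rewrite mulr_gt0 // subr_gt0.
move=> M k; apply: (@le_trans _ _ (expect M 0 k (fun l => expR (zeta / 2 * k%:R) *
    expR (-1) ^+ particles l))).
  apply: le_expect => // l _; rewrite -expRM_natr -expRD mulN1r.
  case: ltP => h /=; last exact: expR_ge0.
  by rewrite -[leLHS]expR0 ler_expR subr_ge0 ltW.
rewrite expectZ; apply: (@le_trans _ _ (expR (zeta / 2 * k%:R) * expR (zeta * (expR (-1) - 1)) ^+ k)).
  by rewrite ler_wpM2l ?expR_ge0 // expect_particles_le // expR_ge0.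
by rewrite -expRM_natr -expRD ler_expR; lra.
Qed.

(** Chernoff bound with base 1 / 2: the sum is at most 2 ^ h (1 - q) ^ (B h) with q = 1 / (4 (1 +
    lambda)), and B q >= 2. *)
Lemma expect_slow_stack M B h : 8 * (1 + lambda) <= B%:R ->
  expect M (B * h) 1 (fun l => (all (fun a => (size a.2 == B * h)%N && (lefts a.2 <= h)%N) l)%:R)
  <= expR (- h%:R).
Proof.
move=> hB; have l1 : 0 < 1 + lambda by rewrite addr_gt0.
rewrite expectS.
pose S : R := \sum_(w <- words (B * h)) word_mass lambda w *
  ((size w == B * h)%N && (lefts w <= h)%N)%:R.
have S0 : 0 <= S by rewrite sumr_ge0 // => w _; rewrite mulr_ge0 ?word_mass_ge0.
under eq_bigr => j _ do under eq_bigr => w _ do rewrite expect0 /= andbT.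
rewrite -/S.
apply: (@le_trans _ _ S).
  rewrite -mulr_suml -[leRHS]mul1r ler_wpM2r //; exact: sum_poisson_le1.
apply: (@le_trans _ _ (\sum_(w <- words (B * h)) word_mass lambda w *
   ((size w == B * h)%N%:R * 2^-1 ^+ lefts w) * 2 ^+ h)).
  apply: ler_sum => w _; rewrite -!mulrA ler_wpM2l ?word_mass_ge0 //.
  case: (_ == _) => /=; rewrite ?mul0r // mul1r.
  case: leqP => lh /=; last by rewrite mulr_ge0 ?exprn_ge0.
  by rewrite exprVn mulrC ler_pdivlMr ?exprn_gt0 // mul1r ler_weXn2l // ler1n.
rewrite -mulr_suml sum_words_size //.
set q := (1 - 2^-1) / (2 * (1 + lambda)).
have qE : q = (4 * (1 + lambda))^-1 by rewrite /q; field; rewrite gt_eqF.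
have qB : 2 <= B%:R * q.
  by rewrite qE ler_pdivlMr ?mulr_gt0 //; lra.
have q0 : 0 <= 1 - q.
  by rewrite qE subr_ge0 invf_le1 ?mulr_gt0 // mulr_ege1 ?ler1n // lerDl ltW.
apply: (@le_trans _ _ (expR (- q) ^+ (B * h) * expR 1 ^+ h)).
  apply: ler_pM; rewrite ?exprn_ge0 //; apply: lerXn2r; rewrite ?nnegrE ?expR_ge0 //.
    exact: expR_ge1Dx.
  by have := expR_ge1Dx (1 : R); lra.
rewrite -!expRM_natr -expRD ler_expR natrM.
have h0 : 0 <= h%:R :> R by [].
have := ler_wpM2r h0 qB; lra.
Qed.

End Estimates.

(** * First-moment bounds *)

Local Open Scope classical_set_scope.
Local Open Scope ring_scope.

(* P A <= b for events A that need not be known to be measurable; the slack e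
   pays for truncating the Poisson variables. *)
Definition covered (R : realType) (d : measure_display) (Omega : measurableType d)
    (P : probability Omega R) (A : set Omega) (b : R) : Prop :=
  forall e : R, 0 < e ->
    exists G, [/\ measurable G, A `<=` G & (P G <= (b + e)%:E)%E].

Section Covered.

Variables (R : realType) (d : measure_display) (Omega : measurableType d).
Variable P : probability Omega R.
Implicit Types (A B : set Omega) (a b : R).

Lemma covered_sub A B b : A `<=` B -> covered P B b -> covered P A b.
Proof.
by move=> AB cB e /cB[G [mG BG PG]]; exists G; split=> //; exact: subset_trans BG.
Qed.

Lemma covered_le A a b : a <= b -> covered P A a -> covered P A b.
Proof.
move=> ab cA e /cA[G [mG AG PG]]; exists G; split=> //.
by apply: le_trans PG _; rewrite lee_fin lerD2r.
Qed.

Lemma covered0 : covered P set0 0.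
Proof. by move=> e e0; exists set0; split => //; rewrite measure0 lee_fin add0r ltW. Qed.

Lemma covered_setU A B a b : covered P A a -> covered P B b -> covered P (A `|` B) (a + b).
Proof.
move=> cA cB e e0; have e2 : 0 < e / 2 by rewrite divr_gt0.
have [G [mG AG PG]] := cA _ e2; have [G' [mG' BG PG']] := cB _ e2.
exists (G `|` G'); split; [exact: measurableU | exact: setUSS |].
apply: le_trans (measureU2 _ mG mG') _.
apply: le_trans (leeD PG PG') _.
by rewrite -EFinD lee_fin; lra.
Qed.

Lemma covered_seq (I : eqType) (s : seq I) (A : I -> set Omega) (b : I -> R) :
  (forall i, i \in s -> covered P (A i) (b i)) ->
  covered P [set w | exists2 i, i \in s & A i w] (\sum_(i <- s) b i).
Proof.
elim: s => [|i s IH] H.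
  by rewrite big_nil; apply: covered_sub covered0 => w [].
rewrite big_cons; apply: (@covered_sub _ (A i `|` [set w | exists2 j, j \in s & A j w])).
  move=> w [j]; rewrite inE => /orP[/eqP ->|js] Aw; first by left.
  by right; exists j.
apply: covered_setU; first by apply: H; rewrite mem_head.
by apply: IH => j js; apply: H; rewrite inE js orbT.
Qed.

Lemma covered_const (I : eqType) (s : seq I) (A : I -> set Omega) b :
  (forall i, i \in s -> covered P (A i) b) ->
  covered P [set w | exists2 i, i \in s & A i w] ((size s)%:R * b).
Proof.
move=> /covered_seq; rewrite big_const_seq count_predT iter_addr_0 mulr_natl; exact.
Qed.

Lemma covered_measurable A b : measurable A -> (P A <= b%:E)%E -> covered P A b.
Proof.
move=> mA PA e e0; exists A; split => //; apply: le_trans PA _.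
by rewrite lee_fin lerDl ltW.
Qed.

Lemma covered_setC A b b' : measurable A -> covered P (~` A) b -> b < b' ->
  ((1 - b')%:E <= P A)%E.
Proof.
move=> mA cA bb; have /cA[G [mG AG PG]] : 0 < b' - b by rewrite subr_gt0.
have h : (P (~` A) <= b'%:E)%E.
  apply: le_trans (le_measure _ _ _ AG) _; rewrite ?inE //; first exact: measurableC.
  by move: PG; rewrite addrC subrK.
move: h; rewrite probability_setC // -(fineK (fin_num_measure P _ mA)).
by rewrite -(EFinB 1) !lee_fin; lra.
Qed.

End Covered.

Section FirstMoment.

Variables (R : realType) (lambda zeta : R) (n : nat).
Hypotheses (lambda_gt0 : 0 < lambda) (zeta_gt0 : 0 < zeta).
Variables (d : measure_display) (Omega : measurableType d) (P : probability Omega R).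
Variables (N : 'I_n -> {RV P >-> nat}) (tau : 'I_n -> nat -> {RV P >-> instruction}).
Hypothesis law : arw_law lambda zeta N tau.

Let tau_at (w : Omega) : stacks n := fun x j => tau x j w.
Let N_at (w : Omega) : 'I_n -> nat := fun x => N x w.

Lemma measurable_N x (B : set nat) : measurable (N x @^-1` B).
Proof. by rewrite -[X in measurable X]setTI; apply: measurable_funP. Qed.

Lemma measurable_tau x j (B : set instruction) : measurable (tau x j @^-1` B).
Proof. by rewrite -[X in measurable X]setTI; apply: measurable_funP. Qed.

Definition cylinder (nu : 'I_n -> nat) (wd : 'I_n -> word) (xs : seq 'I_n) : set Omega :=
  [set w | forall x, x \in xs -> N_at w x = nu x /\ used (tau_at w) x (size (wd x)) = wd x].

Lemma usedP (st : stacks n) x v : used st x (size v) = v <->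
  forall j, (j < size v)%N -> st x j = nth Sleep (rev v) j.
Proof.
split=> [E j jv|H].
  by rewrite -[in RHS]E /used revK nth_mkseq.
apply: (can_inj revK); rewrite /used revK; apply: (@eq_from_nth _ Sleep).
  by rewrite size_mkseq size_rev.
by move=> j; rewrite size_mkseq => jv; rewrite nth_mkseq // H.
Qed.

(** The event constrains finitely many independent variables: the initial numbers on xs and the
    first [size (wd x)] instructions of each x. *)
Lemma cylinder_probability nu wd xs : uniq xs ->
  measurable (cylinder nu wd xs) /\
  P (cylinder nu wd xs) = (mass lambda zeta [seq (nu x, wd x) | x <- xs])%:E.
Proof.
move=> uxs; have [lN lT ind] := law.
pose s : seq ('I_n + 'I_n * nat) :=
  [seq inl x | x <- xs] ++ [seq inr (x, j) | x <- xs, j <- iota 0 (size (wd x))].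
pose A (a : 'I_n + 'I_n * nat) : set Omega := match a with
  | inl x => N x @^-1` [set nu x]
  | inr (x, j) => tau x j @^-1` [set nth Sleep (rev (wd x)) j] end.
have inJ a : (a \in [fset a in s]%fset) = (a \in s) by rewrite in_fset.
have mA a : measurable (A a).
  by case: a => [x|[x j]]; [exact: measurable_N | exact: measurable_tau].
have cE : cylinder nu wd xs = \bigcap_(a in [set` [fset a in s]%fset]) A a.
  apply/seteqP; split=> w /=.
    move=> H a /=; rewrite inJ /s mem_cat => /orP[/mapP[x xxs ->]|].
      by have [] := H x xxs.
    case/allpairsPdep => x [j [xxs]]; rewrite mem_iota add0n => /= jw ->.
    by have [_ /usedP] := H x xxs; apply.
  move=> H x xxs; split.
    by apply: (H (inl x)); rewrite /= inJ /s mem_cat map_f.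
  apply/usedP => j jw; apply: (H (inr (x, j))); rewrite /= inJ /s mem_cat.
  apply/orP; right; apply/allpairsPdep; exists x, j; split => //.
  by rewrite mem_iota.
have us : uniq s.
  rewrite cat_uniq map_inj_uniq ?uxs; last by move=> x y [].
  rewrite allpairs_uniq_dep ?uxs //=; last 2 first.
  - by move=> x _; exact: iota_uniq.
  - by move=> [x j] [x' j'] _ _ [-> ->].
  rewrite andbT; apply/hasPn => a /allpairsPdep[x [j [_ _ ->]]].
  by apply/negP => /mapP[].
have pe : perm_eq (enum_fset [fset a in s]%fset) s.
  by apply: uniq_perm => // a; rewrite inJ.
split.
  by rewrite cE; apply: fin_bigcap_measurable.
rewrite cE ind; last first.
  move=> [x|[x j]] _ /=; first by exists [set nu x].
  by exists [set nth Sleep (rev (wd x)) j].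
rewrite (perm_big _ pe) /= big_cat /= big_map big_allpairs_dep /=.
have -> : (\prod_(x <- xs) P (N x @^-1` [set nu x]) =
           (\prod_(x <- xs) poisson_pmf zeta (nu x))%:E)%E.
  by rewrite -prodEFin; apply: eq_bigr => x _; exact: (lN x (nu x)).
have -> : (\prod_(x <- xs) \prod_(j <- iota 0 (size (wd x)))
    P (tau x j @^-1` [set nth Sleep (rev (wd x)) j]) =
    (\prod_(x <- xs) word_mass lambda (wd x))%:E)%E.
  rewrite -prodEFin; apply: eq_bigr => x _.
  have pr : perm_eq (rev (wd x)) (wd x) by rewrite perm_rev.
  rewrite /word_mass -(perm_big _ pr) /=.
  rewrite (big_nth Sleep) size_rev /index_iota subn0 -prodEFin.
  by apply: eq_bigr => j _; exact: (lT x j _).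
by rewrite -EFinM /mass big_map big_split.
Qed.

Lemma poisson_tail (e : R) : 0 < e -> exists M, forall x, (P [set w | (M <= N x w)%N] <= e%:E)%E.
Proof.
move=> e0; have [lN _ _] := law.
have tailE x M : P [set w | (M <= N x w)%N] = (1 - \sum_(j <- iota 0 M) poisson_pmf zeta j)%:E.
  elim: M => [|M IH].
    rewrite big_nil subr0 -(probability_setT P); congr (P _).
    by apply/seteqP; split.
  have : P [set w | (M <= N x w)%N] = (P [set w | (M.+1 <= N x w)%N] + P (N x @^-1` [set M]))%E.
    rewrite -measureU.
    - congr (P _); apply/seteqP; split=> w /=; last by case=> [/ltnW|->].
      by rewrite leq_eqVlt => /orP[/eqP <-|]; [right | left].
    - exact: (measurable_N x [set k | (M < k)%N]).
    - exact: measurable_N.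
    - by apply/seteqP; split=> w //= [/[swap] ->]; rewrite ltnn.
  have -> : P (N x @^-1` [set M]) = (poisson_pmf zeta M)%:E by exact: (lN x M).
  have fq : P [set w | (M.+1 <= N x w)%N] \is a fin_num.
    by apply: fin_num_measure; exact: (measurable_N x [set k | (M < k)%N]).
  have -> : iota 0 M.+1 = iota 0 M ++ [:: M] by rewrite -addn1 iotaD.
  rewrite IH -(fineK fq) -EFinD big_cat big_seq1 /= => -[h]; congr EFin.
  by rewrite opprD addrA h; ring.
have lim : (\sum_(j <- iota 0 M) poisson_pmf zeta j) @[M --> \oo] --> (1 : R).
  have -> : (fun M => \sum_(j <- iota 0 M) poisson_pmf zeta j) =
     (fun M => series (exp_coeff zeta) M * expR (- zeta)).
    apply/funext => M; rewrite /series /= /index_iota subn0 mulr_suml.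
    by apply: eq_bigr => j _; rewrite /poisson_pmf zeta_gt0.
  rewrite -[X in _ --> X](expRxMexpNx_1 zeta); apply: cvgMr_tmp.
  exact: is_cvg_series_exp_coeff.
have /cvgrPdist_le /(_ e e0)[M _ /(_ M (leqnn M))] := lim.
move=> h; exists M => x; rewrite tailE lee_fin.
exact: le_trans (ler_norm _) h.
Qed.

(** Union bound over the samples satisfying C. The function u may depend on the outcome in any way:
    its data on xs form one of the samples as soon as the particle numbers are below M. *)
Lemma first_moment xs H (C : pred (seq (nat * word))) (b : R) : uniq xs ->
  (forall M, expect lambda zeta M H (size xs) (fun l => (C l)%:R) <= b) ->
  covered P [set w | exists u : 'I_n -> nat, (forall x, (u x <= H)%N) /\
    C [seq site_data (tau_at w) (N_at w) u x | x <- xs]] b.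
Proof.
move=> uxs Hb e e0.
(* One share for the Poisson tail of each site of xs; the extra share keeps the remaining slack
   positive. *)
pose e' := e / (size xs).+1%:R.
have e'0 : 0 < e' by rewrite divr_gt0.
have [M tail] := poisson_tail e'0.
pose nu (l : seq (nat * word)) x := (nth (0%N, [::]) l (index x xs)).1.
pose wd (l : seq (nat * word)) x := (nth (0%N, [::]) l (index x xs)).2.
have tab l : size l = size xs -> [seq (nu l x, wd l x) | x <- xs] = l.
  move=> sl; apply: (@eq_from_nth _ (0%N, [::])); first by rewrite size_map.
  move=> i; rewrite size_map => ixs.
  have [x0 _] : exists x : 'I_n, true by case: xs ixs {uxs Hb e' e'0 tail nu wd sl} => // x; exists x.
  by rewrite (nth_map x0) // /nu /wd index_uniq // -surjective_pairing.
have c1 : covered P [set w | exists2 x, x \in xs & (M <= N x w)%N] (e' * (size xs)%:R).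
  rewrite mulrC; apply: covered_const => x _; apply: covered_measurable (tail x).
  exact: (measurable_N x [set k | (M <= k)%N]).
have c2 : covered P [set w | exists2 l, l \in [seq l <- samples M H (size xs) | C l] &
     cylinder (nu l) (wd l) xs w] b.
  apply: covered_le (Hb M) _; rewrite /expect.
  have -> : \sum_(l <- samples M H (size xs)) mass lambda zeta l * (C l)%:R =
     \sum_(l <- [seq l <- samples M H (size xs) | C l]) mass lambda zeta l.
    rewrite big_filter [RHS]big_mkcond; apply: eq_bigr => l _.
    by case: (C l); rewrite ?mulr1 ?mulr0.
  apply: covered_seq => l; rewrite mem_filter => /andP[_ /size_samples sl].
  have [mc Pc] := cylinder_probability (nu l) (wd l) uxs.
  by apply: covered_measurable mc _; rewrite Pc tab.
have c3 := covered_setU c1 c2.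
have slack : 0 < e - e' * (size xs)%:R.
  rewrite subr_gt0 /e' -mulrA gtr_pMr // mulrC ltr_pdivrMr // mul1r ltr_nat.
  exact: ltnSn.
have [G [mG sG PG]] := c3 _ slack.
exists G; split => //; last by apply: le_trans PG _; rewrite lee_fin; lra.
apply: subset_trans sG => w [u [uH Cu]].
have [big|small] := boolP (has (fun x => M <= N x w)%N xs).
  by left; have /hasP[x xxs Mx] := big; exists x.
right; set l := [seq _ | x <- xs] in Cu; have sl : size l = size xs by rewrite size_map.
have lE x : x \in xs -> nth (0%N, [::]) l (index x xs) = (N_at w x, used (tau_at w) x (u x)).
  by move=> xxs; rewrite (nth_map x) ?index_mem // nth_index.
exists l => [|x xxs]; last by rewrite /nu /wd lE //= size_used.
rewrite mem_filter Cu -sl mem_samples //.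
apply/allP => a /mapP[x xxs ->] /=; rewrite size_used uH andbT ltnNge.
by apply: contra small => h; apply/hasP; exists x.
Qed.

End FirstMoment.

(** * Measurability of the number of topplings *)

Section Measurability.

Variables (R : realType) (n : nat).
Variables (d : measure_display) (Omega : measurableType d) (P : probability Omega R).
Variables (N : 'I_n -> {RV P >-> nat}) (tau : 'I_n -> nat -> {RV P >-> instruction}).

(** The new state of y depends only on its old state, so it can be computed on a constant
    configuration. *)
Definition apply_to_site (x y : 'I_n) (i : instruction) (e : site_state) : site_state :=
  apply_instruction x i (fun=> e) y.

Lemma apply_instructionE x i (eta : config n) y :
  apply_instruction x i eta y = apply_to_site x y i (eta y).
Proof. by rewrite /apply_to_site; case: i; rewrite /apply_instruction /update. Qed.

Lemma measurable_legal_from beta (eta : Omega -> config n) h :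
  (forall x (B : set site_state), measurable [set w | B (eta w x)]) ->
  measurable [set w | legal_from (fun x j => tau x j w) (eta w) h beta].
Proof.
elim: beta eta h => [|x beta IH] eta h meta /=.
  by rewrite (_ : [set w | _] = setT) //; apply/seteqP; split.
have -> : [set w | unstable (eta w x) && legal_from (fun x j => tau x j w)
     (apply_instruction x (tau x (h x) w) (eta w)) (update x S h) beta] =
  [set w | [set e | unstable e] (eta w x)] `&`
  [set w | legal_from (fun x j => tau x j w)
     (apply_instruction x (tau x (h x) w) (eta w)) (update x S h) beta].
  by apply/seteqP; split=> w /=; [move=> /andP[] | case=> -> ->].
apply: measurableI; first exact: meta.
apply: IH => y B.
have part i : measurable (tau x (h x) @^-1` [set i] `&`
    [set w | (B \o apply_to_site x y i) (eta w y)]).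
  by apply: measurableI; [exact: measurable_tau | exact: meta].
have -> : [set w | B (apply_instruction x (tau x (h x) w) (eta w) y)] =
  (tau x (h x) @^-1` [set Sleep] `&` [set w | (B \o apply_to_site x y Sleep) (eta w y)]) `|`
  (tau x (h x) @^-1` [set JumpLeft] `&` [set w | (B \o apply_to_site x y JumpLeft) (eta w y)]) `|`
  (tau x (h x) @^-1` [set JumpRight] `&` [set w | (B \o apply_to_site x y JumpRight) (eta w y)]).
  apply/seteqP; split=> w /=; rewrite apply_instructionE.
    by case E: (tau x (h x) w) => H; [left; left | left; right | right].
  by case=> [[]|] [-> ].
by apply: measurableU; first apply: measurableU.
Qed.

Lemma measurable_arw_total : measurable_fun setT (arw_total N tau : Omega -> \bar R).
Proof.
apply: emeasurable_sum => x.
(* Enumerating the finite sequences makes the odometer a countable supremum. The default value 0 is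
   harmless, as the empty sequence is legal. *)
pose F (k : nat) (w : Omega) : \bar R :=
  if choice.unpickle k is Some beta then
    if legal (fun x j => tau x j w) (fun x => Active (N x w)) beta
    then ((count_mem x beta)%:R)%:E else 0%E
  else 0%E.
have -> : (fun w => odometer R (fun x j => tau x j w) (fun x => Active (N x w)) x) =
   (fun w => esups (F ^~ w) 0).
  apply/funext => w; rewrite /odometer /esups /=; apply/eqP; rewrite eq_le; apply/andP; split.
    apply: ge_ereal_sup => _ [beta /= lb <-]; apply: ereal_sup_ubound.
    by exists (choice.pickle beta) => //; rewrite /F choice.pickleK lb.
  apply: ge_ereal_sup => _ [k _ <-]; apply: ereal_sup_ubound.
  have z : exists2 beta, legal (fun x j => tau x j w) (fun x => Active (N x w)) beta &
      ((count_mem x beta)%:R)%:E = 0%E :> \bar R by exists [::].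
  rewrite /F; case: choice.unpickle => [beta|] //; case: ifP => lb //; by exists beta.
apply: measurable_fun_esups => k; rewrite /F.
case: choice.unpickle => [beta|]; last exact: measurable_cst.
apply: measurable_fun_ifT; [|exact: measurable_cst..].
apply: (measurable_fun_bool true); rewrite setTI.
apply: measurable_legal_from => z B.
exact: (measurable_N N z (fun k => B (Active k))).
Qed.

Lemma topplings_le_odometer tau' eta beta x :
  legal tau' eta beta -> ((topplings beta x)%:R%:E <= @odometer R n tau' eta x)%E.
Proof. by move=> lb; apply: ereal_sup_ubound; exists beta. Qed.

Lemma size_le_total tau' eta beta :
  legal tau' eta beta -> ((size beta)%:R%:E <= @total_topplings R n tau' eta)%E.
Proof.
move=> lb; rewrite -sum_topplings natr_sum -sumEFin.
by apply: lee_sum => x _; exact: topplings_le_odometer.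
Qed.

Lemma total_le tau' eta (v : 'I_n -> nat) :
  (forall beta, legal tau' eta beta -> forall x, (topplings beta x <= v x)%N) ->
  (@total_topplings R n tau' eta <= ((\sum_x v x)%N)%:R%:E)%E.
Proof.
move=> bv; rewrite natr_sum -sumEFin; apply: lee_sum => x _.
by apply: ge_ereal_sup => _ [beta lb <-]; rewrite lee_fin ler_nat; exact: bv.
Qed.

End Measurability.

(** * Slow phase *)

Lemma expR_half_ge (R : realType) : 3 / 2 <= expR (2^-1) :> R.
Proof. by have := expR_ge1Dx (2^-1 : R); lra. Qed.

Lemma expR2_ge5 (R : realType) : 5 <= expR 2 :> R.
Proof.
have -> : 2 = 4%:R * 2^-1 :> R by lra.
rewrite expRM_natl; apply: (@le_trans _ _ ((3 / 2) ^+ 4)); first lra.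
by apply: lerXn2r; rewrite ?nnegrE ?expR_ge0 ?expR_half_ge //; lra.
Qed.

Lemma exp_dominates (R : realType) (c C : R) : 0 < c ->
  \forall n \near \oo, C < expR (c * n%:R).
Proof.
move=> c0; exists (Num.truncn (`|C| / c)).+1 => // n /= Cn.
have : `|C| / c < n%:R by rewrite (lt_le_trans (truncnS_gt _)) // ler_nat.
rewrite ltr_pdivrMr // => h.
have := expR_ge1Dx (c * n%:R); have := ler_norm C; lra.
Qed.

(** Shifting by M indexes the flows in [-M, M] by natural numbers. *)
Lemma flow_code (M r l : nat) (f : int) : (r <= M)%N -> (l <= M)%N -> f = r%:Z - l%:Z ->
  (absz (f + M%:Z)%R < (2 * M).+1)%N /\ (absz (f + M%:Z)%R)%:Z - M%:Z = f.
Proof. by lia. Qed.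

Section Active.

Variables (R : realType) (lambda zeta : R).
Hypotheses (lambda_gt0 : 0 < lambda) (zeta_gt0 : 0 < zeta).
Hypothesis lambda_small : lambda < expR (- (10 / zeta)).

Lemma few_topplings_covered (c : R) n (d : measure_display) (Omega : measurableType d)
    (P : probability Omega R) (N : 'I_n -> {RV P >-> nat})
    (tau : 'I_n -> nat -> {RV P >-> instruction}) : (0 < n)%N ->
  (forall M k, expect lambda zeta M 0 k
     (fun l => ((particles l)%:R < zeta / 2 * k%:R)%R%:R) <= expR (- (c * k%:R))) ->
  arw_law lambda zeta N tau ->
  covered P (~` [set w | ((expR (1 * n%:R))%:E <= arw_total N tau w)%E])
    (expR (- (c * n%:R)) + 6 * expR (10 / zeta) * expR (- n%:R)).
Proof.
move=> n0 scarce law; rewrite mul1r.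
pose a : 'I_n := Ordinal n0.
pose M := Num.truncn (expR n%:R : R).
have ME : M%:R <= expR n%:R :> R by rewrite truncn_le // expR_ge0.
pose c0 := Num.truncn (zeta / 2 * n%:R).
pose xs := stretch a n.
have uxs : uniq xs by rewrite uniq_stretch.
have sxs : size xs = n by rewrite size_stretch.
have lam1 : lambda <= 1.
  apply: le_trans (ltW lambda_small) _.
  by rewrite -expR0 ler_expR oppr_le0 divr_ge0 // ltW.
have hb1 K : expect lambda zeta K 0 (size xs)
    (fun l => ((particles l)%:R < zeta / 2 * n%:R)%R%:R) <= expR (- (c * n%:R)).
  by rewrite sxs; exact: scarce.
have b1 := @first_moment R lambda zeta n zeta_gt0 _ _ P N tau law
  xs 0 (fun l => ((particles l)%:R < zeta / 2 * n%:R)%R) _ uxs hb1.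
(* Possible starts of a chain: r in [0, M] and a flow in [-M, M], hence at most 6 e ^ (2 n)
   pairs. *)
pose I := [seq (r, i) | r <- iota 0 M.+1, i <- iota 0 (2 * M).+1].
pose A (p : nat * nat) := [set w : Omega | exists u : 'I_n -> nat, (forall x, (u x <= M)%N) /\
  (chain p.1 (p.2%:Z - M%:Z) [seq site_data (fun x j => tau x j w) (fun x => N x w) u x | x <- xs]
   && (c0 <= sleepers [seq site_data (fun x j => tau x j w) (fun x => N x w) u x | x <- xs])%N)].
pose b : R := 5 ^+ n * lambda ^+ c0.
have b2 : covered P [set w | exists2 p, p \in I & A p w] ((size I)%:R * b).
  apply: covered_const => p _.
  apply: (@first_moment R lambda zeta n zeta_gt0 _ _ P N tau law
    xs M (fun l => chain p.1 (p.2%:Z - M%:Z) l && (c0 <= sleepers l)%N)) => // K.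
  by rewrite sxs; exact: expect_asleep_chain.
have sI : (size I)%:R <= 6 * (expR n%:R * expR n%:R) :> R.
  rewrite /I size_allpairs !size_iota natrM.
  have e1 : 1 <= expR n%:R :> R by rewrite -expR0 ler_expR.
  have : 6 * (expR n%:R * expR n%:R) = (2 * expR n%:R) * (3 * expR n%:R) :> R by ring.
  move=> ->; apply: ler_pM => //; rewrite -natr1 ?natrM; lra.
(* The bound on lambda gives lambda ^ c0 <= e ^ (10 / zeta - 5 n), where 10 / zeta pays for the
   truncation in c0. With 5 <= e ^ 2 and the e ^ (2 n) starts, a factor e ^ (- n) is left. *)
have bE : b <= expR (10 / zeta) * expR (- (3 * n%:R)).
  rewrite /b; have -> : expR (10 / zeta) * expR (- (3 * n%:R)) =
      expR 2 ^+ n * expR (10 / zeta - 5 * n%:R).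
    by rewrite -expRM_natr -!expRD; congr expR; lra.
  apply: ler_pM; rewrite ?exprn_ge0 ?(ltW lambda_gt0) //.
    by apply: lerXn2r; rewrite ?nnegrE ?expR_ge0 ?expR2_ge5.
  apply: (@le_trans _ _ (expR (- (10 / zeta)) ^+ c0)).
    by apply: lerXn2r; rewrite ?nnegrE ?expR_ge0 ?(ltW lambda_gt0) // ltW.
  rewrite -expRM_natr ler_expR.
  have : zeta / 2 * n%:R < c0.+1%:R by rewrite truncnS_gt.
  rewrite -natr1 => h.
  have z10 : 0 < 10 / zeta by rewrite divr_gt0.
  have := ler_wpM2l (ltW z10) (ltW h).
  have -> : 10 / zeta * (zeta / 2 * n%:R) = 5 * n%:R by field; rewrite gt_eqF.
  lra.
have tot : (size I)%:R * b <= 6 * expR (10 / zeta) * expR (- n%:R).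
  have -> : 6 * expR (10 / zeta) * expR (- n%:R) =
     6 * (expR n%:R * expR n%:R) * (expR (10 / zeta) * expR (- (3 * n%:R))) :> R.
    have -> : expR (- n%:R) = expR n%:R * expR n%:R * expR (- (3 * n%:R)) :> R.
      by rewrite -!expRD; congr expR; lra.
    ring.
  by apply: ler_pM => //; rewrite mulr_ge0 ?exprn_ge0 // ltW.
apply: covered_sub (covered_setU b1 (covered_le tot b2)) => w /= /negP.
rewrite -ltNge => Tlt.
have bM beta : legal (fun x j => tau x j w) (fun x => Active (N x w)) beta -> (size beta <= M)%N.
  move=> /(@size_le_total R)/le_lt_trans/(_ Tlt); rewrite lte_fin => /ltW.
  by rewrite truncn_ge_nat // expR_ge0.
have [u uM us] := bounded_stabilization bM.
pose st : stacks n := fun x j => tau x j w.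
have sa : all (settled st (fun x => N x w) u) (stretch a n) by apply/allP.
have ch := settled_chain sa; have fl := flow_stretch sa.
set l := [seq _ | x <- _] in ch fl.
rewrite /= iter_ordS_n in fl.
(* The flow takes the same value again after a full turn. *)
have sp : sleepers l = particles l by clear -fl; lia.
have lE : l = [seq site_data st (fun x => N x w) u x | x <- xs] by [].
have [few|many] := ltP ((particles l)%:R : R) (zeta / 2 * n%:R).
  left; exists (fun=> 0%N); split => //.
  by rewrite (_ : particles _ = particles l) // /particles -!map_comp.
right.
have rM : (rights (used st a (u a)) <= M)%N.
  by apply: leq_trans (uM a); rewrite -[X in (_ <= X)%N](size_used st a) count_size.
have lM : (lefts (used st (ordS a) (u (ordS a))) <= M)%N.
  by apply: leq_trans (uM (ordS a)); rewrite -[X in (_ <= X)%N](size_used st (ordS a)) count_size.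
have [i_lt iE] := flow_code rM lM (erefl (flow st u a)).
exists (rights (used st a (u a)), absz (flow st u a + M%:Z)%R).
  apply/allpairsP; exists (rights (used st a (u a)), absz (flow st u a + M%:Z)%R).
  by rewrite !mem_iota !add0n; split.
exists u; split => //=; rewrite -/st -lE.
rewrite iE.
rewrite ch sp /=.
have := many; rewrite /c0; set t := zeta / 2 * n%:R => tp.
by rewrite -(ler_nat R); apply: le_trans tp; rewrite truncn_le // /t mulr_ge0 // divr_ge0 // ltW.
Qed.

Lemma slow_stabilization : exists delta delta' : R, [/\ 0 < delta, 0 < delta' &
  \forall n \near \oo,
  forall (d : measure_display) (Omega : measurableType d)
    (P : probability Omega R) (N : 'I_n -> {RV P >-> nat})
    (tau : 'I_n -> nat -> {RV P >-> instruction}),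
  arw_law lambda zeta N tau ->
  ((1 - expR (- delta * n%:R))%:E <=
   P [set w | (expR (delta' * n%:R))%:E <= arw_total N tau w])%E].
Proof.
have [c c0 scarce] := expect_scarce lambda_gt0 zeta_gt0.
(* The other half of the exponent absorbs the constant 1 + C for large n. *)
pose delta := Num.min c 1 / 2.
have m0 : 0 < Num.min c 1 by rewrite lt_min c0 ltr01.
have delta0 : 0 < delta by rewrite divr_gt0.
have dc : delta + delta <= c.
  by rewrite /delta; have := ge_min c c 1; rewrite lexx /=; lra.
have d1 : delta + delta <= 1.
  by rewrite /delta; have := ge_min 1 c 1; rewrite lexx orbT /=; lra.
exists delta, 1; split => //.
near=> n => d Omega P N tau law.
have n0 : (0 < n)%N by near: n; exists 1%N.
apply: (covered_setC _ (few_topplings_covered n0 scarce law)).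
  rewrite -[X in measurable X]setTI.
  exact: emeasurable_fun_c_infty (measurable_arw_total N tau) _.
set C := 6 * expR (10 / zeta).
have big : 1 + C < expR (delta * n%:R) by near: n; exact: exp_dominates.
have C0 : 0 <= C by rewrite mulr_ge0 // expR_ge0.
apply: (@le_lt_trans _ _ ((1 + C) * expR (- (delta * n%:R) - delta * n%:R))).
  rewrite mulrDl mul1r; apply: lerD.
    by rewrite ler_expR; have := ler_wpM2r (ler0n R n) dc; lra.
  by rewrite ler_wpM2l // ler_expR; have := ler_wpM2r (ler0n R n) d1; lra.
rewrite expRD mulrA mulNr gtr_pMl ?expR_gt0 // mulrC expRN.
by rewrite mulrC ltr_pdivrMr ?expR_gt0 // mul1r.
Unshelve. all: by end_near. Qed.

End Active.

(** * Fast phase *)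

Lemma covered_and (R : realType) (d : measure_display) (Omega : measurableType d)
    (P : probability Omega R) (c : bool) (A : set Omega) (b : R) :
  0 <= b -> (c -> covered P A b) -> covered P [set w | c /\ A w] b.
Proof.
move=> b0; case: c => [/(_ isT)|_].
  by apply: covered_sub => w [].
by apply: covered_le b0 _; apply: covered_sub (covered0 P) => w [].
Qed.

Lemma odometer_sum_simpl B n ell : (ell <= n)%N ->
  (n * (B * (17 * ell * ell)) + ell * (B * (17 * ell * (ell + n))) <=
   51 * B * n * (ell * ell))%N.
Proof.
move=> h; have : (B * (ell * ell) * ell <= B * (ell * ell) * n)%N by rewrite leq_mul2l h orbT.
nia.
Qed.

Lemma thresholds_ge n ell : (0 < ell)%N -> (ell <= n)%N ->
  [/\ (ell <= 17 * ell * ell)%N, (ell <= 17 * ell * (ell + n))%N &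
      (ell <= 32 * n * n + 2 * n)%N].
Proof. by move=> ell0 elln; split; nia. Qed.

Lemma card_triples_le n : (0 < n)%N -> (n * (n.+1 * n.+1) <= 8 * n ^ 3)%N.
Proof.
move=> n0; have -> : (8 * n ^ 3 = n * (8 * (n * n)))%N by rewrite mulnCA.
by rewrite leq_mul2l; apply/orP; right; nia.
Qed.

Section Fixating.

Variables (R : realType) (lambda zeta theta : R).
Hypotheses (zeta_gt0 : 0 < zeta) (zeta_theta : zeta < theta) (theta_lt1 : theta < 1).
Hypothesis lambda_large : expR (3 / (1 - theta)) < lambda.

Let lambda_gt0 : 0 < lambda.
Proof. exact: lt_trans (expR_gt0 _) lambda_large. Qed.

Let theta_gt0 : 0 < theta. Proof. exact: lt_trans zeta_theta. Qed.

Let dens (k : nat) : nat := Num.truncn (theta * k%:R).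

Lemma dens_le k : (dens k)%:R <= theta * k%:R.
Proof. by rewrite truncn_le // mulr_ge0 // ltW. Qed.

(** At least (1 - theta) k words end with a jump, and lambda is large enough for (1 + lambda) ^ ((1
    - theta) k) >= e ^ (3 k), against 4 ^ k <= e ^ (2 k). *)
Lemma full_chain_small M H k r f :
  expect lambda zeta M H k
    (fun l => [&& chain r f l, all (fun a => 0 < size a.2)%N l & (sleepers l <= dens k)%N]%:R)
  <= expR (- k%:R).
Proof.
apply: le_trans (expect_full_chain lambda_gt0 zeta_gt0 _ _ _ _ _ _) _.
have l1 : 0 < 1 + lambda by rewrite addr_gt0.
have t1 : 0 < 1 - theta by rewrite subr_gt0.
have dk := dens_le k.
have dk' : (dens k <= k)%N.
  rewrite -(ler_nat R); apply: le_trans dk _.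
  by rewrite -[leRHS]mul1r ler_wpM2r // ltW.
have h : expR (3 * k%:R) <= (1 + lambda) ^+ (k - dens k).
  apply: (@le_trans _ _ (expR (3 / (1 - theta)) ^+ (k - dens k))).
    rewrite -expRM_natr ler_expR natrB // mulrAC ler_pdivlMr //.
    by have := dk; lra.
  by apply: lerXn2r; rewrite ?nnegrE ?expR_ge0 ?(ltW l1) //; have := lambda_large; lra.
apply: (@le_trans _ _ (4 ^+ k * expR (- (3 * k%:R)))).
  rewrite ler_wpM2l ?exprn_ge0 // expRN lef_pV2 ?posrE ?expR_gt0 //.
  by rewrite exprn_gt0.
have -> : - k%:R = 2 * k%:R + - (3 * k%:R) :> R by ring.
rewrite expRD ler_wpM2r ?expR_ge0 // expRM_natr.
apply: lerXn2r; rewrite ?nnegrE ?expR_ge0 //.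
by have := expR2_ge5 R; lra.
Qed.

Variable B : nat.
Hypothesis B_large : 8 * (1 + lambda) <= B%:R.
Variable c : R.
Hypothesis crowded : forall M k,
  expect lambda zeta M 0 k (fun l => (theta * k%:R < (particles l)%:R)%R%:R) <= expR (- (c * k%:R)).

(** Outside the events [Bad], the hypotheses of [subcritical_bound] hold. There are at most 8 n ^ 3
    indices, each with seven events of cost e ^ (- g ell), hence the factor 56. *)
Lemma many_topplings_covered n ell (g : R) (d : measure_display) (Omega : measurableType d)
    (P : probability Omega R) (N : 'I_n -> {RV P >-> nat})
    (tau : 'I_n -> nat -> {RV P >-> instruction}) :
  (0 < ell)%N -> (4 * ell < n)%N -> 0 < g -> g <= c -> g <= 1 ->
  arw_law lambda zeta N tau ->
  covered P (~` [set w | (arw_total N tau w <= ((51 * B * n * (ell * ell))%N%:R)%:E)%E])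
    (56 * n%:R ^+ 3 * expR (- (g * ell%:R))).
Proof.
move=> ell0 elln g0 gc g1 law; have ell_n : (ell <= n)%N.
  by apply: leq_trans (ltnW elln); rewrite leq_pmull.
have n0 : (0 < n)%N by exact: leq_trans ell0 ell_n.
have [ge1 ge2 ge3] := thresholds_ge ell0 ell_n.
pose H := (B * (32 * n * n + 2 * n))%N.
pose st (w : Omega) : stacks n := fun x j => tau x j w.
pose Nw (w : Omega) (x : 'I_n) := N x w.
pose ev (a : 'I_n) k H' (C : pred (seq (nat * word))) : set Omega :=
  [set w | exists u : 'I_n -> nat, (forall x, (u x <= H')%N) /\
     C [seq site_data (st w) (Nw w) u x | x <- stretch a k]].
pose b : R := expR (- (g * ell%:R)).
have b0 : 0 <= b by exact: expR_ge0.
have fm a k H' (C : pred (seq (nat * word))) : (k <= n)%N ->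
    (forall M, expect lambda zeta M H' k (fun l => (C l)%:R) <= b) -> covered P (ev a k H' C) b.
  move=> kn Cb; apply: (@first_moment R lambda zeta n zeta_gt0 _ _ P N tau law).
    exact: uniq_stretch.
  by move=> M; rewrite size_stretch.
have eb k : (ell <= k)%N -> expR (- k%:R) <= b.
  move=> lk; rewrite ler_expR lerN2; apply: (@le_trans _ _ ell%:R); last by rewrite ler_nat.
  by rewrite -[leRHS]mul1r ler_wpM2r.
pose E1 (a : 'I_n) k := [set w | (ell <= k <= n)%N /\
  ev a k 0%N (fun l => (theta * k%:R < (particles l)%:R)%R) w].
pose E2 (a : 'I_n) k m := [set w | (ell <= k <= n)%N /\
  ev a k H (fun l => [&& chain 0 (- m%:Z) l, all (fun a => 0 < size a.2)%N l &
                        (sleepers l <= dens k)%N]) w].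
pose E3 (q : nat) (a : 'I_n) k m := [set w | (k <= q)%N && (k <= n)%N /\
  ev a k H (fun l => chain 0 (- m%:Z) l && (16 * q * (q + m) <= last_rights 0 l)%N) w].
pose E4 (h : nat) (a : 'I_n) :=
  ev a 1%N (B * h)%N (all (fun z => (size z.2 == B * h)%N && (lefts z.2 <= h)%N)).
have c1 a k : covered P (E1 a k) b.
  apply: covered_and => // /andP[lk kn]; apply: fm => // M.
  apply: le_trans (crowded M k) _; rewrite ler_expR lerN2.
  apply: (@le_trans _ _ (g * k%:R)); first by rewrite ler_wpM2l ?(ltW g0) // ler_nat.
  by rewrite ler_wpM2r.
have c2 a k m : covered P (E2 a k m) b.
  apply: covered_and => // /andP[lk kn]; apply: fm => // M.
  by apply: le_trans (full_chain_small _ _ _ _ _) _; exact: eb.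
have c3 q a k m : (ell <= q)%N -> covered P (E3 q a k m) b.
  move=> lq; apply: covered_and => // /andP[kq kn]; apply: fm => // M.
  apply: le_trans (expect_high_chain lambda_gt0 zeta_gt0 _ _ _ _ kq) _; last exact: eb.
  exact: leq_trans lq.
have c4 h a : (ell <= h)%N -> covered P (E4 h a) b.
  move=> lh; apply: fm => //.
  move=> M; apply: le_trans (expect_slow_stack lambda_gt0 zeta_gt0 M h B_large) _.
  exact: eb.
pose h1 := (17 * ell * ell)%N; pose h2 := (17 * ell * (ell + n))%N.
pose h3 := (32 * n * n + 2 * n)%N.
pose T := [seq (a, km) | a <- enum 'I_n, km <- [seq (k, m) | k <- iota 0 n.+1, m <- iota 0 n.+1]].
pose Bad (t : 'I_n * (nat * nat)) : set Omega :=
  E1 t.1 t.2.1 `|` (E2 t.1 t.2.1 t.2.2 `|` (E3 ell t.1 t.2.1 t.2.2 `|`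
  (E3 n t.1 t.2.1 t.2.2 `|` (E4 h1 t.1 `|` (E4 h2 t.1 `|` E4 h3 t.1))))).
have cBad t : covered P (Bad t) (b + (b + (b + (b + (b + (b + b)))))).
  apply: covered_setU => //; apply: covered_setU => //.
  apply: covered_setU; first exact: c3.
  apply: covered_setU; first exact: c3 ell_n.
  by apply: covered_setU; [|apply: covered_setU]; exact: c4.
have cT := covered_const (s := T) (fun t _ => cBad t).
have sT : (size T)%:R <= 8 * n%:R ^+ 3 :> R.
  rewrite /T !size_allpairs size_enum_ord !size_iota.
  by rewrite -!natrX -natrM ler_nat card_triples_le.
apply: covered_sub (covered_le _ cT); last first.
  have -> : 56 * n%:R ^+ 3 * b = (8 * n%:R ^+ 3) * (b + (b + (b + (b + (b + (b + b)))))).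
    by ring.
  by rewrite ler_wpM2r // !addr_ge0.
move=> w /= nT; apply: contrapT => nBad; apply: nT.
have good a k m : (k <= n)%N -> (m <= n)%N -> ~ Bad (a, (k, m)) w.
  move=> kn mn bad; apply: nBad; exists (a, (k, m)) => //.
  apply/allpairsP; exists (a, (k, m)); rewrite mem_enum; split => //.
  by apply/allpairsP; exists (k, m); rewrite !mem_iota.
have quick h (a : 'I_n) : ~ E4 h a w -> (h < lefts (used (st w) (ordS a) (B * h)))%N.
  move=> nE; rewrite ltnNge; apply/negP => hl; apply: nE.
  by exists (fun=> (B * h)%N); split => //=; rewrite size_used eqxx hl.
have quick' h (x : 'I_n) : (forall a, ~ E4 h a w) -> (h < lefts (used (st w) x (B * h)))%N.
  by move=> nE; rewrite -(ord_predK x); apply: quick.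
have sparse (a : 'I_n) k : (ell <= k <= n)%N -> (sumn [seq Nw w x | x <- stretch a k] <= dens k)%N.
  move=> lkn; have kn : (k <= n)%N by case/andP: lkn.
  rewrite truncn_ge_nat ?mulr_ge0 ?(ltW theta_gt0) //.
  rewrite leNgt; apply/negP => cr; apply: (good a k 0%N) => //; left; split => //.
  exists (fun=> 0%N); split => //; rewrite /particles -map_comp.
  by move: cr.
have few : (\sum_x Nw w x <= n)%N.
  have a : 'I_n by exact: Ordinal n0.
  have := sparse a n; rewrite leqnn andbT sumnE big_map.
  have pe : perm_eq (stretch a n) (index_enum 'I_n).
    apply: uniq_perm; [exact: uniq_stretch | exact: index_enum_uniq|].
    move=> x; rewrite mem_index_enum; apply/stretchP.
    have [i iN ->] := iter_ordS_onto (ordS a) x.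
    by exists i.+1; rewrite ?iterSr // iN.
  rewrite (perm_big _ pe) /= => /(_ ell_n) h; apply: leq_trans h _.
  rewrite -(ler_nat R); apply: le_trans (dens_le n) _.
  by rewrite -[leRHS]mul1r ler_wpM2r // ltW.
have nofull (u : 'I_n -> nat) (a : 'I_n) k m0 : (forall x, (u x <= H)%N) ->
    (ell <= k < n)%N -> (m0 <= n)%N -> all (fun x => 0 < u x)%N (stretch a k) ->
    chain 0 (- m0%:Z) [seq site_data (st w) (Nw w) u x | x <- stretch a k] ->
    (dens k < sleepers [seq site_data (st w) (Nw w) u x | x <- stretch a k])%N.
  move=> uH lkn mn pos ch; have kn : (k <= n)%N by case/andP: lkn => _ /ltnW.
  rewrite ltnNge; apply/negP => sl; apply: (good a k m0) => //; right; left; split.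
    by rewrite kn andbT; case/andP: lkn.
  exists u; split => //; rewrite ch sl andbT /= all_map.
  by apply: sub_all pos => x /=; rewrite size_used.
have low q : (q == ell) || (q == n) -> forall (u : 'I_n -> nat) (a : 'I_n) k m0,
    (forall x, (u x <= H)%N) -> (k <= q)%N -> (k < n)%N -> (m0 <= n)%N ->
    chain 0 (- m0%:Z) [seq site_data (st w) (Nw w) u x | x <- stretch a k] ->
    (last_rights 0 [seq site_data (st w) (Nw w) u x | x <- stretch a k] < 16 * q * (q + m0))%N.
  move=> qE u a k m0 uH kq kn mn ch; rewrite ltnNge; apply/negP => hi.
  have e3 : E3 q a k m0 w.
    split; first by rewrite kq ltnW.
    by exists u; split => //; rewrite ch hi.
  by case/orP: qE e3 => /eqP -> e3; apply: (good a k m0 (ltnW kn) mn);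
    right; right; [left | right; left].
have q1 x : (h1 < lefts (used (st w) x (B * h1)))%N.
  by apply: quick' => a e4; apply: (good a 0 0)%N => //; do 4 right; left.
have q2 x : (h2 < lefts (used (st w) x (B * h2)))%N.
  by apply: quick' => a e4; apply: (good a 0 0)%N => //; do 5 right; left.
have q3 x : (h3 < lefts (used (st w) x (B * h3)))%N.
  by apply: quick' => a e4; apply: (good a 0 0)%N => //; do 6 right.
have [v [vs lv]] := subcritical_bound ell0 elln few sparse (leqnn H) nofull
  (low ell (introT orP (or_introl (eqxx ell))))
  (low n (introT orP (or_intror (eqxx n)))) q1 q2 q3.
apply: le_trans (total_le _ lv) _; rewrite lee_fin ler_nat.
exact: leq_trans vs (odometer_sum_simpl _ ell_n).
Qed.

End Fixating.

Lemma fast_stabilization (R : realType) (lambda zeta theta : R) :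
  0 < zeta -> zeta < theta -> theta < 1 -> expR (3 / (1 - theta)) < lambda ->
  exists delta kappa : R, 0 < delta /\
    \forall n \near \oo,
    forall (d : measure_display) (Omega : measurableType d)
      (P : probability Omega R) (N : 'I_n -> {RV P >-> nat})
      (tau : 'I_n -> nat -> {RV P >-> instruction}),
    arw_law lambda zeta N tau ->
    ((1 - n%:R `^ (- delta))%:E <=
     P [set w | arw_total N tau w <= (kappa * n%:R * ln n%:R ^+ 2)%:E])%E.
Proof.
move=> zeta0 zt t1 lamL; have lam0 : 0 < lambda by exact: lt_trans (expR_gt0 _) lamL.
have [c c0 crowded] := expect_crowded lam0 zeta0 zt.
pose g := Num.min c 1; have g0 : 0 < g by rewrite lt_min c0 ltr01.
have gc : g <= c by rewrite ge_min lexx.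
have g1 : g <= 1 by rewrite ge_min lexx orbT.
(* With g * ell >= 5 ln n, the bad events cost at most 56 n ^ 3 n ^ (-5), which is below 1 / n from
   n = 57 on. *)
pose A := 5 / g; have A0 : 0 < A by rewrite divr_gt0.
pose B := (Num.truncn (8 * (1 + lambda))).+1.
have Bl : 8 * (1 + lambda) <= B%:R by rewrite ltW // truncnS_gt.
exists 1, (51 * B%:R * (A + 1) ^+ 2); split => //.
(* Having ln n > 8 A + 6 ensures 4 * ell < n, by a quadratic lower bound on the exponential. *)
exists ((Num.truncn (expR (8 * A + 6))).+1 + 57)%N => // n /= nbig d Omega P N tau law.
have n57 : 57 <= n%:R :> R by rewrite ler_nat (leq_trans _ nbig) // leq_addl.
have n0 : 0 < n%:R :> R by apply: lt_le_trans n57.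
have nexp : expR (8 * A + 6) < n%:R.
  by apply: lt_le_trans (truncnS_gt _) _; rewrite ler_nat (leq_trans _ nbig) // leq_addr.
pose L : R := ln n%:R.
have LE : expR L = n%:R by rewrite lnK // posrE.
have LA : 8 * A + 6 < L by rewrite -ltr_expR LE.
have L1 : 1 <= L by lra.
pose ell := (Num.truncn (A * L)).+1.
have AL0 : 0 <= A * L by rewrite mulr_ge0 // ltW // (lt_le_trans _ L1).
have ell_ge : A * L <= ell%:R by rewrite ltW // truncnS_gt.
have ell_le : ell%:R <= A * L + 1 by rewrite -natr1 lerD2r truncn_le.
have ell0 : (0 < ell)%N by []; clearbody ell.
have elln : (4 * ell < n)%N.
  rewrite -(ltr_nat R) natrM; apply: (@le_lt_trans _ _ (4 * (A * L) + 4)).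
    by have := ell_le; rewrite (_ : 4%:R = 4 :> R) //; lra.
  rewrite -LE; apply: lt_le_trans (expR_ge1Dxn 1 (le_trans ler01 L1)).
  have h : 2 * (A * L) * 4 + 6 * L <= L ^+ 2.
    have := ler_wpM2r (le_trans ler01 L1) (ltW LA); rewrite expr2; lra.
  rewrite (_ : 2`!%:R = 2) //; lra.
have cov := many_topplings_covered zeta0 zt t1 lamL Bl crowded ell0 elln g0 gc g1 law.
have powE : n%:R `^ (- 1) = n%:R^-1 :> R by rewrite powR_inv1 // ltW.
rewrite powE; apply: (covered_setC _ (covered_sub _ cov)).
- rewrite -[X in measurable X]setTI.
  exact: emeasurable_fun_infty_c (measurable_arw_total N tau) _.
- apply: subsetC => w /= /le_trans; apply; rewrite lee_fin !natrM expr2.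
  have -> : 51 * B%:R * ((A + 1) * (A + 1)) * n%:R * ln n%:R ^+ 2 =
     51 * B%:R * n%:R * (((A + 1) * L) * ((A + 1) * L)) by rewrite /L; ring.
  have e : ell%:R <= (A + 1) * L by have := ell_le; lra.
  by rewrite ler_wpM2l ?mulr_ge0 // ler_pM.
- have h : expR (- (g * ell%:R)) <= n%:R^-1 ^+ 5.
    rewrite exprVn -LE -expRM_natl -expRN ler_expR lerN2.
    apply: le_trans (ler_wpM2l (ltW g0) ell_ge).
    by rewrite /A mulrA mulrCA mulfV ?gt_eqF // mulr1.
  apply: (@le_lt_trans _ _ (56 * n%:R ^+ 3 * n%:R^-1 ^+ 5)).
    by rewrite ler_wpM2l // mulr_ge0 // exprn_ge0 // ltW.
  have -> : 56 * n%:R ^+ 3 * n%:R^-1 ^+ 5 = 56 * n%:R^-1 * n%:R^-1 :> R.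
    by field; rewrite gt_eqF.
  rewrite gtr_pMl ?invr_gt0 // ltr_pdivrMr // mul1r; lra.
Qed.

Theorem theorem6p1 (R : realType) (zeta : R) (zeta_gt0 : 0 < zeta)
    (zeta_lt1 : zeta < 1) :
  (exists2 lambda0 : R, 0 < lambda0 &
     forall lambda : R, 0 < lambda -> lambda < lambda0 ->
     exists delta delta' : R, [/\ 0 < delta, 0 < delta' &
       \forall n \near \oo,
       forall (d : measure_display) (Omega : measurableType d)
         (P : probability Omega R) (N : 'I_n -> {RV P >-> nat})
         (tau : 'I_n -> nat -> {RV P >-> instruction}),
       arw_law lambda zeta N tau ->
       ((1 - expR (- delta * n%:R))%:E <=
        P [set w | (expR (delta' * n%:R))%:E <= arw_total N tau w])%E])
  /\
  (exists2 lambda1 : R, 0 < lambda1 &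
     forall lambda : R, lambda1 < lambda ->
     exists delta kappa : R, 0 < delta /\
       \forall n \near \oo,
       forall (d : measure_display) (Omega : measurableType d)
         (P : probability Omega R) (N : 'I_n -> {RV P >-> nat})
         (tau : 'I_n -> nat -> {RV P >-> instruction}),
       arw_law lambda zeta N tau ->
       ((1 - n%:R `^ (- delta))%:E <=
        P [set w | arw_total N tau w <= (kappa * n%:R * ln n%:R ^+ 2)%:E])%E).
Proof.
split.
  exists (expR (- (10 / zeta))); first exact: expR_gt0.
  by move=> lambda lambda_gt0 lambda_small; exact: slow_stabilization.
(* Any density strictly between zeta and 1 would do for theta; the midpoint is taken. *)
exists (expR (3 / (1 - (zeta + 1) / 2))); first exact: expR_gt0.
move=> lambda lambda_large.
by apply: (@fast_stabilization R lambda zeta ((zeta + 1) / 2)) => //; lra.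
Qed.
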